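(* For each $n \ge 1$ let $B^{(n)} \subset \mathbb{R}^n$ be the Euclidean ball of radius $\sqrt n$ centered at the origin. Then the sequence $(B^{(n)})_{n \ge 1}$ is noise stable, but $M(B^{(n)}) \le n^{-1/2}$ for every $n$.
   Context: $\gamma_n$ is the standard Gaussian measure on $\mathbb{R}^n$; $\mathbb{E}$, $\mathrm{Var}$, $\mathrm{Cov}$ of functions on $\mathbb{R}^n$ are taken with respect to $\gamma_n$. $P_t$ is the Ornstein-Uhlenbeck semigroup, $P_t f(x) = \mathbb{E} f(e^{-t} x + \sqrt{1-e^{-2t}}\, X)$ with $X \sim \gamma_n$. A sequence of sets $A_i \subset \mathbb{R}^{n_i}$ is noise sensitive if $\mathrm{Var}(P_t 1_{A_i}) \to 0$ as $i \to \infty$ for all $t>0$; otherwise it is noise stable. A half-space in $\mathbb{R}^n$ is a set of the form $\{x \in \mathbb{R}^n : \langle x, a\rangle \le b\}$ with $a \in \mathbb{R}^n$, $b \in \mathbb{R}$; $\mathcal{H}_n$ is the set of all half-spaces. For $B \subset \mathbb{R}^n$ measurable, $M(B) = \sup_{A \in \mathcal{H}_n} \mathrm{Cov}(1_A, 1_B)$. *)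

(* Defs.v *)
From HB Require Import structures.
From mathcomp Require Import all_boot all_order all_algebra.
From mathcomp Require Import all_classical all_reals all_analysis.

Set Implicit Arguments.
Unset Strict Implicit.
Unset Printing Implicit Defensive.

Import Order.TTheory GRing.Theory Num.Theory.
Import numFieldNormedType.Exports.

Local Open Scope ring_scope.
Local Open Scope classical_set_scope.

(* R^n is n.-tuple R, which carries the product (= Borel) sigma-algebra.
   The normed space 'rV[R]_n is not used: it has the sup norm and no
   measurable structure. *)

Section euclidean.
Variable R : realType.

Definition dotp n (x y : n.-tuple R) : R :=
  \sum_(i < n) tnth x i * tnth y i.

Definition enorm n (x : n.-tuple R) : R := Num.sqrt (dotp x x).

Definition lincomb n (a b : R) (x y : n.-tuple R) : n.-tuple R :=
  [tuple a * tnth x i + b * tnth y i | i < n].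

Definition eball n (r : R) : set (n.-tuple R) := [set x | enorm x <= r].

Definition half_space n (a : n.-tuple R) (b : R) : set (n.-tuple R) :=
  [set x | dotp x a <= b].

Definition sqrt_ball n : set (n.-tuple R) := eball (Num.sqrt n%:R).

(* a = 0 is allowed, so set0 and setT are half-spaces *)
Definition half_spaces n : set (set (n.-tuple R)) :=
  [set A | exists a b, A = half_space a b].

End euclidean.

Arguments sqrt_ball R n : clear implicits.
Arguments half_spaces R n : clear implicits.

Section gaussian.
Variable R : realType.

Definition cons_fun n (p : measurableTypeR R * n.-tuple R) : n.+1.-tuple R :=
  [the n.+1.-tuple R of p.1 :: p.2].

Lemma measurable_cons_fun n : measurable_fun [set: _] (@cons_fun n).
Proof.
exact: (@measurable_cons _ _ (measurableTypeR R * n.-tuple R)%type R).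
Qed.

HB.instance Definition _ n :=
  isMeasurableFun.Build _ _ _ _ (@cons_fun n) (@measurable_cons_fun n).

(* standard Gaussian measure: the n-fold product of N(0, 1) *)
Fixpoint gauss n : probability (n.-tuple R) R :=
  match n with
  | 0 => \d_([tuple] : 0.-tuple R)
  | m.+1 => distribution (normal_prob (0 : R) 1 \x gauss m)%E (@cons_fun m)
  end.

End gaussian.

Section noise.
Variable R : realType.

(* Ornstein-Uhlenbeck semigroup P_t f (x) *)
Definition ou n (t : R) (f : n.-tuple R -> R) (x : n.-tuple R) : R :=
  fine ('E_(gauss R n)[fun y =>
    f (lincomb (expR (- t)) (Num.sqrt (1 - expR (- (2 * t)))) x y)])%E.

(* d i is the dimension of the space containing A i; the A i are meant to be
   measurable *)
Definition noise_sensitive (d : nat -> nat)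
    (A : forall i, set ((d i).-tuple R)) : Prop :=
  forall t : R, 0 < t ->
    ('V_(gauss R (d i))[ou t (\1_(A i))])%E @[i --> \oo] --> 0%E.

Definition noise_stable (d : nat -> nat)
    (A : forall i, set ((d i).-tuple R)) : Prop := ~ noise_sensitive A.

Definition maxcov n (B : set (n.-tuple R)) : \bar R :=
  ereal_sup [set covariance (gauss R n) \1_A \1_B | A in half_spaces R n].

End noise.

(* Main.v *)
From HB Require Import structures.
Require Import Defs.
From mathcomp Require Import all_boot all_order all_algebra.
From mathcomp Require Import all_classical all_reals all_analysis.
From mathcomp Require Import measurable_realfun.
From mathcomp Require Import ring lra.
Set Implicit Arguments.
Unset Strict Implicit.
Unset Printing Implicit Defensive.
Import Order.TTheory GRing.Theory Num.Theory.
Import numFieldNormedType.Exports.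
Local Open Scope classical_set_scope.
Local Open Scope ring_scope.

(** Both halves rest on the rotation invariance of the Gaussian measure. In the
plane it follows from that of Lebesgue measure, because a rotation is a product
of three shears and a shear is, on each line, a translation
([ge0_integral_normal_rotation]). Induction on the dimension turns it into two
statements on R^n: the joint law of (<x, a>, |x|^2) depends on a only through
|a| ([ge0_integral_gauss_direction]), and a pair of independent Gaussian vectors
is invariant under (x, y) |-> (c x + s y, - s x + c y) when c^2 + s^2 = 1
([ge0_integral_gauss_rotation]).

Half-spaces. The ball B is invariant under rotations, so the covariance c of 1_B
with the indicator of the half-space {<x, a> <= b} is also its covariance with
each of the n independent indicators 1{|a| x_i <= b}. Hence n c is the
covariance of 1_B with the sum of these indicators, a sum whose variance is at
most n, and the Cauchy-Schwarz inequality gives n c <= sqrt n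
([covariance_half_space_le]).

Noise stability. The witness is the second Hermite direction
S(x) = \sum_i (1 - x_i^2) = n - |x|^2, which is nonnegative exactly on B. Being
in the second chaos, it satisfies E[S P_t f] = rho^2 E[S f] with rho = e^(-t)
([Rintegral_coord_sum_onem_sqr_ou]; the proof rotates the pair (X, Y) in Mehler's formula
instead of diagonalizing P_t). Since E S = 0, E[S 1_B] = E|S| / 2, and this is
at least of order sqrt n because E S^2 is proportional to n while E S^4 = O(n^2)
([coord_sum_moments], [abs_moment_lower_bound]). The Cauchy-Schwarz inequality
between S and P_t 1_B - E[P_t 1_B] then bounds Var(P_t 1_B) from below by a
positive number independent of n ([variance_ou_sqrt_ball_ge_ge]). *)

(** * Integration against a density *)

Section density.
Local Open Scope ereal_scope.
Context d (T : measurableType d) (R : realType).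
Variables (mu nu : {measure set T -> \bar R}) (p : T -> R).
Hypothesis mp : measurable_fun [set: T] p.
Hypothesis p_ge0 : forall x, (0 <= p x)%R.
Hypothesis nuE : forall A, measurable A -> nu A = \int[mu]_(x in A) (p x)%:E.

Import HBNNSimple.

(** The hypothesis is the case of indicators; simple functions follow by
additivity and nonnegative functions by monotone convergence. *)
Lemma ge0_integral_density (f : T -> \bar R) :
  measurable_fun [set: T] f -> (forall x, 0 <= f x) ->
  \int[nu]_x f x = \int[mu]_x (f x * (p x)%:E).
Proof.
move=> mf f0.
pose f_ := nnsfun_approx measurableT mf.
have indicE_ (E : set T) : measurable E ->
    \int[nu]_x (\1_E x)%:E = \int[mu]_x ((\1_E x)%:E * (p x)%:E).
  move=> mE; rewrite integral_indic//= setIT nuE// integral_mkcond/=.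
  apply: eq_integral => x _; rewrite patchE indicE.
  by case: ifPn => xE; rewrite ?mul1e ?mul0e.
have mpE : measurable_fun [set: T] (EFin \o p) by exact/measurable_EFinP.
have sfE (h : {nnsfun T >-> R}) :
    \int[nu]_x (h x)%:E = \int[mu]_x ((h x)%:E * (p x)%:E).
  under [LHS]eq_integral do rewrite fimfunE -fsumEFin//.
  rewrite [LHS]ge0_integral_fsum//; last 2 first.
    - by move=> r; exact/measurable_EFinP/measurableT_comp.
    - by move=> n x _; rewrite EFinM nnfun_muleindic_ge0.
  under [RHS]eq_integral.
    move=> x xD; rewrite fimfunE -fsumEFin// ge0_mule_fsuml; last first.
      by move=> r; rewrite EFinM nnfun_muleindic_ge0.
    over.
  rewrite [RHS]ge0_integral_fsum//; last 2 first.
    - move=> r; apply: emeasurable_funM => //.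
      by apply/measurable_EFinP; apply/measurableT_comp => //.
    - move=> n x _; apply: mule_ge0; last by rewrite lee_fin.
      by rewrite EFinM nnfun_muleindic_ge0.
  apply: eq_fsbigr => r _.
  rewrite integralZl_indic_nnsfun//= indicE_//.
  have [r0|r0] := leP 0%R r; last first.
    rewrite preimage_nnfun0//= integral0_eq ?mule0 => [|x _]; last first.
      by rewrite indicE in_set0 mul0e.
    by rewrite integral0_eq// => x _; rewrite indicE in_set0 mulr0 mul0e.
  rewrite -ge0_integralZl//.
  - by apply: eq_integral => x _; rewrite EFinM muleA.
  - apply: emeasurable_funM => //.
    exact/measurable_EFinP/measurable_indic.
  - by move=> x _; rewrite mule_ge0 ?lee_fin.
transitivity (lim (\int[nu]_x (f_ n x)%:E @[n --> \oo])).
  rewrite -monotone_convergence//=.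
  - apply: eq_integral => ? /[!inE] xD; apply/esym/cvg_lim => //=.
    exact: cvg_nnsfun_approx.
  - by move=> n; exact/measurable_EFinP/measurable_funTS.
  - by move=> n ? _; rewrite lee_fin.
  - by move=> ? _ ? ? mn; rewrite lee_fin; exact/lefP/nd_nnsfun_approx.
under eq_fun do rewrite sfE.
rewrite -monotone_convergence//=.
- apply: eq_integral => x _; apply/cvg_lim => //.
  rewrite muleC; under eq_fun do rewrite muleC.
  by apply: cvgeZl => //; exact: cvg_nnsfun_approx.
- move=> n; apply: emeasurable_funM => //.
  exact/measurable_EFinP/measurable_funTS.
- by move=> n x _; rewrite mule_ge0 ?lee_fin.
- move=> x _ m n mn; rewrite lee_pmul ?lee_fin//.
  exact/lefP/nd_nnsfun_approx.
Qed.

End density.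

(** * Rotations of Lebesgue measure in the plane *)

Section measurable_plane.
Context {R : realType}.

Lemma measurable_comp_linear2 (G : R * R -> \bar R) (k l m n : R) :
  measurable_fun [set: R * R] G ->
  measurable_fun [set: R * R] (fun z => G (k * z.1 + l * z.2, m * z.1 + n * z.2)).
Proof.
move=> mG; apply: measurableT_comp mG _.
by apply: measurable_fun_pair; apply: measurable_funD; apply: measurable_funM.
Qed.

End measurable_plane.

Section lebesgue_plane.
Local Open Scope ereal_scope.
Context {R : realType}.
Local Notation mu := (@lebesgue_measure R).

Lemma lebesgue_measure_shift (c : R) (A : set (measurableTypeR R)) : measurable A ->
  pushforward mu ((fun x => x + c)%R : _ -> measurableTypeR R) A = mu A.
Proof.
move=> mA.
have mc : measurable_fun [set: measurableTypeR R]
    ((fun x => x + c)%R : _ -> measurableTypeR R).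
  exact: measurable_funD.
pose X := isMeasurableFun.Build _ _ _ _ _ mc.
pose s : {mfun measurableTypeR R >-> measurableTypeR R} := HB.pack
  ((fun x => x + c)%R : measurableTypeR R -> measurableTypeR R) X.
apply/esym/(@lebesgue_measure_unique _ (pushforward mu s)) => //= _ [[a b]] _ <-.
rewrite /pushforward (_ : _ @^-1` _ = `](a - c)%R, (b - c)%R]%classic)/=.
  rewrite !lebesgue_measure_itv/= !lte_fin ltrD2r -!EFinB.
  by have -> : (b - c - (a - c) = b - a)%R by ring.
by apply/seteqP; split => x/=; rewrite !in_itv/= ltrBlDr lerBrDr.
Qed.

Lemma ge0_integral_lebesgue_shift (c : R) (f : R -> \bar R) :
  measurable_fun [set: R] f -> (forall x, 0 <= f x) ->
  \int[mu]_x f (x + c)%R = \int[mu]_x f x.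
Proof.
move=> mf f0.
have mc : measurable_fun [set: measurableTypeR R]
    ((fun x => x + c)%R : _ -> measurableTypeR R).
  exact: measurable_funD.
pose X := isMeasurableFun.Build _ _ _ _ _ mc.
pose s : {mfun measurableTypeR R >-> measurableTypeR R} := HB.pack
  ((fun x => x + c)%R : measurableTypeR R -> measurableTypeR R) X.
transitivity (\int[pushforward mu s]_x f x); last first.
  by apply: eq_measure_integral => A mA _; exact: lebesgue_measure_shift.
by rewrite ge0_integral_pushforward.
Qed.


Lemma ge0_integral_lebesgue_shear (c : R) (F : R * R -> \bar R) :
  measurable_fun [set: R * R] F -> (forall z, 0 <= F z) ->
  \int[mu]_y \int[mu]_x F (x + c * y, y)%R = \int[mu]_y \int[mu]_x F (x, y).
Proof.
move=> mF F0; apply: eq_integral => y _.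
rewrite (ge0_integral_lebesgue_shift (c * y) (f := fun x => F (x, y)))//.
exact: measurableT_comp mF (measurable_fun_pair _ _).
Qed.

(** The rotation matrix is the product of the shears (1 a; 0 1), (1 0; -s 1) and
(1 a; 0 1), where a = (1 - c) / s. *)
Lemma ge0_integral_lebesgue_rotation (c s : R) (F : R * R -> \bar R) :
  (c ^+ 2 + s ^+ 2 = 1)%R -> s != 0%R ->
  measurable_fun [set: R * R] F -> (forall z, 0 <= F z) ->
  \int[mu]_y \int[mu]_x F (c * x + s * y, - s * x + c * y)%R =
  \int[mu]_y \int[mu]_x F (x, y).
Proof.
move=> cs1 s0 mF F0.
pose a : R := ((1 - c) / s)%R.
pose G1 (z : R * R) := F (z.1 + a * z.2, z.2)%R.
pose G2 (z : R * R) := G1 (z.1, z.2 + - s * z.1)%R.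
have mG1 : measurable_fun [set: R * R] G1.
  apply: eq_measurable_fun (measurable_comp_linear2 1%R a 0%R 1%R mF) => z _.
  by rewrite /G1 !mul1r mul0r add0r.
have mG2 : measurable_fun [set: R * R] G2.
  apply: eq_measurable_fun (measurable_comp_linear2 1%R 0%R (- s)%R 1%R mG1) => z _.
  by rewrite /G2 !mul1r mul0r addr0 (addrC z.2).
have swap (G : R * R -> \bar R) : measurable_fun [set: R * R] G ->
    (forall z, 0 <= G z) ->
    \int[mu]_y \int[mu]_x G (x, y) = \int[mu]_x \int[mu]_y G (x, y).
  by move=> mG G0; rewrite (@fubini_tonelli _ _ _ _ _ mu mu G).
transitivity (\int[mu]_y \int[mu]_x G2 (x + a * y, y)%R).
  apply: eq_integral => y _; apply: eq_integral => x _.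
  rewrite /G2 /G1/=; congr (F (_, _)); last by rewrite /a; field.
  (* the entry 2 a - s a^2 of the product is (1 - c^2) / s *)
  have -> : (s * y = (1 - c ^+ 2) / s * y)%R.
    by rewrite -cs1 addrAC subrr add0r expr2 mulfK.
  by rewrite /a; field.
rewrite (ge0_integral_lebesgue_shear _ mG2 (fun z => F0 _)).
(* the middle shear acts along the other axis *)
pose G1' (z : R * R) := G1 (z.2, z.1).
have mG1' : measurable_fun [set: R * R] G1'.
  apply: measurableT_comp mG1 _.
  exact: measurable_fun_pair.
rewrite (swap _ mG2 (fun z => F0 _)); transitivity (\int[mu]_y \int[mu]_x G1' (x, y)).
  by apply: (ge0_integral_lebesgue_shear (- s)%R mG1') => z; exact: F0.
rewrite -[LHS]/(\int[mu]_x \int[mu]_y G1 (x, y)) -(swap _ mG1 (fun z => F0 _)).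
exact: (ge0_integral_lebesgue_shear a mF F0).
Qed.

End lebesgue_plane.

(** * Rotations of the Gaussian measure in the plane *)

Section normal_plane.
Local Open Scope ereal_scope.
Context {R : realType}.
Local Notation mu := (@lebesgue_measure R).
Local Notation N := (normal_prob (0 : R) 1).

Lemma ge0_integral_normal (f : R -> \bar R) :
  measurable_fun [set: R] f -> (forall x, 0 <= f x) ->
  \int[N]_x f x = \int[mu]_x (f x * (normal_pdf 0 1 x)%:E).
Proof.
move=> mf f0; apply: ge0_integral_density => //.
- exact: measurable_normal_pdf.
- by move=> x; exact: normal_pdf_ge0.
Qed.

Lemma normal_pdf_rotation (c s x y : R) : (c ^+ 2 + s ^+ 2 = 1)%R ->
  (normal_pdf 0 1 (c * x + s * y) * normal_pdf 0 1 (- s * x + c * y) =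
   normal_pdf 0 1 x * normal_pdf 0 1 y :> R)%R.
Proof.
move=> cs1; rewrite !normal_pdfE ?oner_eq0// /normal_fun !subr0.
rewrite mulrACA [RHS]mulrACA -!expRD; congr (_ * expR _)%R.
rewrite -!mulrDl; congr (_ / _)%R.
have -> : (x ^+ 2 = (c ^+ 2 + s ^+ 2) * x ^+ 2)%R by rewrite cs1 mul1r.
have -> : (y ^+ 2 = (c ^+ 2 + s ^+ 2) * y ^+ 2)%R by rewrite cs1 mul1r.
ring.
Qed.

Lemma ge0_integral_normal2 (F : R * R -> \bar R) :
  measurable_fun [set: R * R] F -> (forall z, 0 <= F z) ->
  \int[N]_x \int[N]_y F (x, y) =
  \int[mu]_x \int[mu]_y (F (x, y) * (normal_pdf 0 1 x * normal_pdf 0 1 y)%:E).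
Proof.
move=> mF F0.
have mFx x : measurable_fun [set: R] (fun y => F (x, y)).
  exact: measurableT_comp mF (measurable_fun_pair _ _).
have mp : measurable_fun [set: R] (EFin \o @normal_pdf R 0 1).
  apply/measurable_EFinP; exact: measurable_normal_pdf.
rewrite ge0_integral_normal; last 2 first.
- exact: (@measurable_fun_fubini_tonelli_F _ _ _ (measurableTypeR R) R N F mF F0).
- by move=> x; apply: integral_ge0.
apply: eq_integral => x _; rewrite ge0_integral_normal// -ge0_integralZr//.
- by apply: eq_integral => y _; rewrite -muleA -EFinM mulrC.
- by apply: emeasurable_funM; [exact: mFx|exact: mp].
- by move=> y _; rewrite mule_ge0// lee_fin normal_pdf_ge0.
- by rewrite lee_fin normal_pdf_ge0.
Qed.

(** Lebesgue measure and the density, a function of x^2 + y^2, are both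
rotation invariant. *)
Lemma ge0_integral_normal_rotation (c s : R) (F : R * R -> \bar R) :
  (c ^+ 2 + s ^+ 2 = 1)%R ->
  measurable_fun [set: R * R] F -> (forall z, 0 <= F z) ->
  \int[N]_x \int[N]_y F (c * x + s * y, - s * x + c * y)%R =
  \int[N]_x \int[N]_y F (x, y).
Proof.
have nonz (c' s' : R) (G : R * R -> \bar R) : (c' ^+ 2 + s' ^+ 2 = 1)%R ->
    s' != 0%R -> measurable_fun [set: R * R] G -> (forall z, 0 <= G z) ->
    \int[N]_x \int[N]_y G (c' * x + s' * y, - s' * x + c' * y)%R =
    \int[N]_x \int[N]_y G (x, y).
  move=> cs1 s0 mG G0.
  rewrite (ge0_integral_normal2 (measurable_comp_linear2 c' s' (- s')%R c' mG)
    (fun z => G0 _)).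
  rewrite (ge0_integral_normal2 mG G0).
  pose H (z : R * R) := G (z.2, z.1) * (normal_pdf 0 1 z.2 * normal_pdf 0 1 z.1)%:E.
  transitivity (\int[mu]_x \int[mu]_y
      H (c' * y + (- s') * x, - (- s') * y + c' * x)%R).
    apply: eq_integral => x _; apply: eq_integral => y _; rewrite /H/= opprK.
    rewrite -(normal_pdf_rotation x y cs1).
    by congr (G (_, _) * (normal_pdf _ _ _ * normal_pdf _ _ _)%:E); ring.
  apply: (ge0_integral_lebesgue_rotation (F := H)).
  - by rewrite sqrrN.
  - by rewrite oppr_eq0.
  - apply: emeasurable_funM.
      apply: measurableT_comp mG _; exact: measurable_fun_pair.
    apply/measurable_EFinP; apply: measurable_funM;
      apply: measurableT_comp => //; exact: measurable_normal_pdf.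
  - by move=> z; rewrite mule_ge0// lee_fin mulr_ge0// normal_pdf_ge0.
move=> cs1 mF F0; have [s0|] := eqVneq s 0%R; last by move=> ?; exact: nonz.
(* when s = 0 the rotation is the identity or the square of a quarter turn *)
have := cs1; rewrite s0 expr0n addr0 => /eqP; rewrite sqrf_eq1 => /orP[]/eqP ->.
  apply: eq_integral => x _; apply: eq_integral => y _.
  by rewrite oppr0 !mul1r !mul0r addr0 add0r.
have q1 : (0 ^+ 2 + 1 ^+ 2 = 1 :> R)%R by rewrite expr0n add0r expr1n.
rewrite -(nonz 0%R 1%R F q1 (oner_neq0 _) mF F0).
rewrite -(nonz 0%R 1%R _ q1 (oner_neq0 _)
  (measurable_comp_linear2 0%R 1%R (- 1)%R 0%R mF) (fun z => F0 _)).
apply: eq_integral => x _; apply: eq_integral => y _.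
by rewrite /=; congr (F (_, _)); ring.
Qed.

End normal_plane.

(** * Rotations of the Gaussian measure in dimension n *)

Section gauss_tuple.
Local Open Scope ereal_scope.
Context {R : realType}.
Local Notation N := (normal_prob (0 : R) 1).
Local Notation gauss := (gauss R).

Lemma tnth_cons_funS n (p : R * n.-tuple R) i :
  tnth (cons_fun p) (lift ord0 i) = tnth p.2 i.
Proof. exact: tnthS. Qed.

Lemma cons_funP n (x : n.+1.-tuple R) : exists p : R * n.-tuple R, x = cons_fun p.
Proof.
by exists (thead x, [tuple of behead x]); rewrite [LHS]tuple_eta; apply/val_inj.
Qed.

Lemma dotpxx_ge0 n (x : n.-tuple R) : (0 <= dotp x x)%R.
Proof. by rewrite /dotp sumr_ge0// => i _; rewrite -expr2 sqr_ge0. Qed.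

Lemma dotp_cons_fun n (p q : R * n.-tuple R) :
  (dotp (cons_fun p) (cons_fun q) = p.1 * q.1 + dotp p.2 q.2)%R.
Proof.
rewrite /dotp big_ord_recl; congr (_ + _)%R.
by apply: eq_bigr => i _; rewrite !tnth_cons_funS.
Qed.

Lemma lincomb_cons_fun n (a b : R) (p q : R * n.-tuple R) :
  lincomb a b (cons_fun p) (cons_fun q) =
  cons_fun (a * p.1 + b * q.1, lincomb a b p.2 q.2)%R.
Proof.
apply: eq_from_tnth => i; rewrite tnth_mktuple.
case: (unliftP ord0 i) => [j ->|->]; last by [].
by rewrite !tnth_cons_funS tnth_mktuple.
Qed.

Lemma measurable_dotp d (T : measurableType d) n (f g : T -> n.-tuple R) :
  measurable_fun [set: T] f -> measurable_fun [set: T] g ->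
  measurable_fun [set: T] (fun x => dotp (f x) (g x)).
Proof.
move=> /measurable_fun_tnthP mf /measurable_fun_tnthP mg.
by apply: measurable_sum => i; apply: measurable_funM; [exact: mf|exact: mg].
Qed.

Lemma measurable_lincomb d (T : measurableType d) n (a b : R) (f g : T -> n.-tuple R) :
  measurable_fun [set: T] f -> measurable_fun [set: T] g ->
  measurable_fun [set: T] (fun x => lincomb a b (f x) (g x)).
Proof.
move=> /measurable_fun_tnthP mf /measurable_fun_tnthP mg.
apply/measurable_fun_tnthP => i.
rewrite (_ : _ \o _ = fun x => a * tnth (f x) i + b * tnth (g x) i)%R.
  by apply: measurable_funD; apply: measurable_funM => //; [exact: mf|exact: mg].
by apply/funext => x /=; rewrite tnth_mktuple.
Qed.

Lemma measurable_cons_fun2 d (T : measurableType d) n (f : T -> R)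
    (g : T -> n.-tuple R) :
  measurable_fun [set: T] f -> measurable_fun [set: T] g ->
  measurable_fun [set: T] (fun x => cons_fun (f x, g x)).
Proof. exact: measurable_cons. Qed.

Lemma ge0_integral_gaussS n (f : n.+1.-tuple R -> \bar R) :
  measurable_fun [set: n.+1.-tuple R] f -> (forall x, 0 <= f x) ->
  \int[gauss n.+1]_x f x = \int[N]_x \int[gauss n]_y f (cons_fun (x, y)).
Proof.
move=> mf f0; rewrite ge0_integral_distribution//.
rewrite (@fubini_tonelli1 _ _ (measurableTypeR R) (n.-tuple R) R N (gauss n)
  (f \o @cons_fun R n))//.
  by apply: measurableT_comp => //; exact: measurable_cons_fun.
by move=> z; exact: f0.
Qed.

Lemma ge0_integral_gauss2S n (F : n.+1.-tuple R * n.+1.-tuple R -> \bar R) :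
  measurable_fun [set: n.+1.-tuple R * n.+1.-tuple R] F -> (forall x, 0 <= F x) ->
  \int[gauss n.+1]_x \int[gauss n.+1]_y F (x, y) =
  \int[N]_x \int[N]_y \int[gauss n]_x' \int[gauss n]_y'
    F (cons_fun (x, x'), cons_fun (y, y')).
Proof.
move=> mF F0.
rewrite ge0_integral_gaussS; last 2 first.
- exact: (@measurable_fun_fubini_tonelli_F _ _ _ _ R (gauss n.+1) F mF F0).
- by move=> x; exact: integral_ge0.
apply: eq_integral => x _.
rewrite -(@fubini_tonelli _ _ (n.-tuple R) (measurableTypeR R) R (gauss n) N
  (fun z => \int[gauss n]_y' F (cons_fun (x, z.1), cons_fun (z.2, y'))))/=.
- apply: eq_integral => x' _; rewrite ge0_integral_gaussS//.
  exact: measurableT_comp mF (measurable_fun_pair _ _).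
- apply: (@measurable_fun_fubini_tonelli_F _ _ (n.-tuple R * measurableTypeR R)%type
    (n.-tuple R) R (gauss n)
    (fun w => F (cons_fun (x, w.1.1), cons_fun (w.1.2, w.2)))) => //.
  apply: measurableT_comp mF _; apply: measurable_fun_pair.
    by apply: measurable_cons_fun2 => //; exact: measurableT_comp.
  by apply: measurable_cons_fun2 => //; exact: measurableT_comp.
- by move=> z; exact: integral_ge0.
Qed.

(** The rotation acts on each pair of coordinates (x_i, y_i) separately, so the
planar case applies to the first pair and induction to the others. *)
Lemma ge0_integral_gauss_rotation n (c s : R) (F : n.-tuple R * n.-tuple R -> \bar R) :
  (c ^+ 2 + s ^+ 2 = 1)%R ->
  measurable_fun [set: n.-tuple R * n.-tuple R] F -> (forall z, 0 <= F z) ->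
  \int[gauss n]_x \int[gauss n]_y F (lincomb c s x y, lincomb (- s) c x y) =
  \int[gauss n]_x \int[gauss n]_y F (x, y).
Proof.
move=> cs1; elim: n F => [|n IHn] F mF F0.
  apply: eq_integral => x _; apply: eq_integral => y _.
  by congr (F (_, _)); apply: eq_from_tnth => -[].
rewrite (ge0_integral_gauss2S (F := fun z =>
  F (lincomb c s z.1 z.2, lincomb (- s)%R c z.1 z.2)))//; last first.
  apply: measurableT_comp mF _.
  by apply: measurable_fun_pair; exact: measurable_lincomb.
rewrite [RHS](ge0_integral_gauss2S mF F0).
pose G (z : R * R) := \int[gauss n]_x' \int[gauss n]_y'
  F (cons_fun (z.1, x'), cons_fun (z.2, y')).
have mG : measurable_fun [set: R * R] G.
  apply: (@measurable_fun_fubini_tonelli_F _ _ _ _ R (gauss n)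
    (fun w : (R * R) * n.-tuple R => \int[gauss n]_y'
       F (cons_fun (w.1.1, w.2), cons_fun (w.1.2, y')))); last first.
    by move=> z; exact: integral_ge0.
  apply: (@measurable_fun_fubini_tonelli_F _ _ _ _ R (gauss n)
    (fun w : ((R * R) * n.-tuple R) * n.-tuple R =>
       F (cons_fun (w.1.1.1, w.1.2), cons_fun (w.1.1.2, w.2)))) => //.
  apply: measurableT_comp mF _.
  apply: measurable_fun_pair; apply: measurable_cons_fun2 => //.
  - by apply: measurableT_comp => //; exact: measurableT_comp.
  - exact: measurableT_comp.
  - by apply: measurableT_comp => //; exact: measurableT_comp.
transitivity (\int[N]_x \int[N]_y G (c * x + s * y, - s * x + c * y)%R); last first.
  apply: (ge0_integral_normal_rotation cs1 mG) => z.
  by apply: integral_ge0 => x _; exact: integral_ge0.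
apply: eq_integral => x _; apply: eq_integral => y _.
pose H (w : n.-tuple R * n.-tuple R) := F (cons_fun (c * x + s * y, w.1)%R,
  cons_fun (- s * x + c * y, w.2)%R).
transitivity (\int[gauss n]_x' \int[gauss n]_y'
    H (lincomb c s x' y', lincomb (- s) c x' y')%R); last first.
  apply: (IHn H) => [|z]; last exact: F0.
  apply: measurableT_comp mF _.
  by apply: measurable_fun_pair; exact: measurable_cons_fun2.
by apply: eq_integral => x' _; apply: eq_integral => y' _; rewrite !lincomb_cons_fun.
Qed.

Lemma ge0_integral_normalN (f : R -> \bar R) :
  measurable_fun [set: R] f -> (forall x, 0 <= f x) ->
  \int[N]_x f (- x)%R = \int[N]_x f x.
Proof.
move=> mf f0.
have E (g : R -> \bar R) : \int[N]_x \int[N]_y g x = \int[N]_x g x.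
  by apply: eq_integral => x _; rewrite integral_cst//= probability_setT mule1.
have q1 : ((-1) ^+ 2 + 0 ^+ 2 = 1 :> R)%R by rewrite sqrrN expr1n expr0n addr0.
have mff : measurable_fun [set: R * R] (f \o fst) by exact: measurableT_comp.
have := ge0_integral_normal_rotation q1 mff (fun z => f0 _); rewrite /= E => <-.
rewrite -E; apply: eq_integral => x _; apply: eq_integral => y _.
by congr f; ring.
Qed.

(** The direction (s, a) of R^(n + 1) is rotated onto the first axis: by
induction a may be taken along the first axis of R^n, and a planar rotation then
merges the first two coordinates. Keeping the first coordinate apart lets the
induction start at n = 0, where only the sign of s is left to correct. *)
Lemma ge0_integral_normal_gauss_direction n (s : R) (a : n.-tuple R)
    (F : R * R -> \bar R) :
  measurable_fun [set: R * R] F -> (forall z, 0 <= F z) ->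
  \int[N]_x \int[gauss n]_y F (s * x + dotp y a, x ^+ 2 + dotp y y)%R =
  \int[N]_x \int[gauss n]_y F (Num.sqrt (s ^+ 2 + dotp a a) * x, x ^+ 2 + dotp y y)%R.
Proof.
elim: n s a F => [|n IHn] s a F mF F0.
  have dot0 (x y : 0.-tuple R) : dotp x y = 0%R by rewrite /dotp big_ord0.
  under eq_integral do under eq_integral do rewrite !dot0 !addr0.
  under [RHS]eq_integral do under eq_integral do rewrite !dot0 !addr0.
  rewrite sqrtr_sqr; have [s0|s0] := leP 0%R s; first by rewrite ger0_norm.
  pose f x := \int[gauss 0]_y F (`|s| * x, x ^+ 2)%R.
  have mf : measurable_fun [set: R] f.
    apply: (eq_measurable_fun (fun x => F (`|s| * x, x ^+ 2)%R)) => [x _|].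
      by rewrite /f integral_cst//= probability_setT mule1.
    apply: measurableT_comp mF _; apply: measurable_fun_pair.
      exact: measurable_funM.
    exact: measurable_funX.
  rewrite -[RHS](ge0_integral_normalN mf); last by move=> x; exact: integral_ge0.
  apply: eq_integral => x _; apply: eq_integral => y _.
  by rewrite ltr0_norm// mulrN mulNr opprK sqrrN.
have [[a0 a'] ->] := cons_funP a.
pose r := Num.sqrt (a0 ^+ 2 + dotp a' a').
have r2 : (r ^+ 2 = a0 ^+ 2 + dotp a' a')%R.
  by rewrite sqr_sqrtr// addr_ge0 ?sqr_ge0 ?dotpxx_ge0.
rewrite dotp_cons_fun/= -expr2 -r2; set q := Num.sqrt _.
have q2 : (q ^+ 2 = s ^+ 2 + r ^+ 2)%R by rewrite sqr_sqrtr// addr_ge0 ?sqr_ge0.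
have split (f : R * n.+1.-tuple R -> R) : measurable_fun [set: R * n.+1.-tuple R] f ->
    \int[N]_x \int[gauss n.+1]_y F (f (x, y), x ^+ 2 + dotp y y)%R =
    \int[N]_x \int[N]_y \int[gauss n]_z F (f (x, cons_fun (y, z)),
       x ^+ 2 + (y ^+ 2 + dotp z z))%R.
  move=> mf; apply: eq_integral => x _; rewrite [LHS]ge0_integral_gaussS; last 2 first.
  - apply: measurableT_comp mF _; apply: measurable_fun_pair.
      by apply: measurableT_comp mf _; exact: measurable_fun_pair.
    by apply: measurable_funD => //; exact: measurable_dotp.
  - by move=> y; exact: F0.
  by under eq_integral do under eq_integral do rewrite dotp_cons_fun/= -expr2.
pose G (z : R * R) := \int[gauss n]_w F (q * z.1, z.1 ^+ 2 + (z.2 ^+ 2 + dotp w w))%R.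
have mG : measurable_fun [set: R * R] G.
  apply: (@measurable_fun_fubini_tonelli_F _ _ _ _ R (gauss n)
    (fun z : (R * R) * _ =>
       F (q * z.1.1, z.1.1 ^+ 2 + (z.1.2 ^+ 2 + dotp z.2 z.2))%R)) => //.
  apply: measurableT_comp mF _; apply: measurable_fun_pair.
    by apply: measurable_funM => //; exact: measurableT_comp.
  apply: measurable_funD; first by apply: measurable_funX; exact: measurableT_comp.
  apply: measurable_funD; first by apply: measurable_funX; exact: measurableT_comp.
  exact: measurable_dotp.
transitivity (\int[N]_x \int[N]_y G (x, y)); last first.
  rewrite (split (fun z => q * z.1)%R)//.
  by apply: measurable_funM => //; exact: measurable_fst.
transitivity (\int[N]_x \int[N]_y \int[gauss n]_z F (s * x + r * y,
     x ^+ 2 + (y ^+ 2 + dotp z z))%R).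
  rewrite (split (fun z => s * z.1 + dotp z.2 (cons_fun (a0, a')))%R); last first.
    by apply: measurable_funD; [exact: measurable_funM|exact: measurable_dotp].
  apply: eq_integral => x _.
  under eq_integral do under eq_integral do rewrite dotp_cons_fun/= (mulrC _ a0).
  apply: (IHn a0 a' (fun w => F (s * x + w.1, x ^+ 2 + w.2)%R)) => //.
  apply: measurableT_comp mF _; apply: measurable_fun_pair; exact: measurable_funD.
clearbody q r.
have [q0|q0] := eqVneq q 0%R.
  have /andP[/eqP s0 /eqP r0] : (s == 0%R) && (r == 0%R).
    have : (s ^+ 2 + r ^+ 2 == 0)%R by rewrite -q2 q0 expr0n.
    by rewrite paddr_eq0 ?sqr_ge0// !sqrf_eq0.
  apply: eq_integral => x _; apply: eq_integral => y _.
  by rewrite /G/= s0 r0 q0 !mul0r addr0.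
have cs1 : ((s / q) ^+ 2 + (r / q) ^+ 2 = 1)%R.
  by rewrite !expr_div_n -mulrDl -q2 divff// sqrf_eq0.
rewrite -(ge0_integral_normal_rotation cs1 mG); last first.
  by move=> z; exact: integral_ge0.
apply: eq_integral => x _; apply: eq_integral => y _; apply: eq_integral => w _ /=.
congr (F (_, _)); first by field.
rewrite !addrA; congr (_ + _)%R.
transitivity (((s / q) ^+ 2 + (r / q) ^+ 2) * (x ^+ 2 + y ^+ 2))%R.
  by rewrite cs1 mul1r.
by ring.
Qed.

Lemma ge0_integral_gauss_direction n (a b : n.-tuple R) (F : R * R -> \bar R) :
  dotp a a = dotp b b ->
  measurable_fun [set: R * R] F -> (forall z, 0 <= F z) ->
  \int[gauss n]_x F (dotp x a, dotp x x) = \int[gauss n]_x F (dotp x b, dotp x x).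
Proof.
case: n a b => [|n] a b.
  by move=> *; apply: eq_integral => x _; rewrite /dotp !big_ord0.
have [[a0 a'] ->] := cons_funP a; have [[b0 b'] ->] := cons_funP b.
move=> ab mF F0.
have E (c0 : R) (c' : n.-tuple R) :
    \int[gauss n.+1]_x F (dotp x (cons_fun (c0, c')), dotp x x) =
    \int[N]_x \int[gauss n]_y
      F (Num.sqrt (dotp (cons_fun (c0, c')) (cons_fun (c0, c'))) * x, x ^+ 2 + dotp y y)%R.
  rewrite dotp_cons_fun/= -expr2 -ge0_integral_normal_gauss_direction//.
  rewrite [LHS]ge0_integral_gaussS; last 2 first.
  - by apply: measurableT_comp mF _; apply: measurable_fun_pair; exact: measurable_dotp.
  - by move=> x; exact: F0.
  under eq_integral do under eq_integral do
    rewrite !dotp_cons_fun/= -expr2 (mulrC _ c0).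
  by [].
by rewrite E ab -E.
Qed.

End gauss_tuple.

(** * Moments of the standard normal law *)

Section normal_moments.
Context {R : realType}.
Local Notation N := (normal_prob (0 : R) 1).

(** Up to a factor, the integrand is the density of another centered normal
law, of variance 1 / (1 - 2 k). *)
Lemma integral_normal_expR_sqr (k : R) : k < 2^-1 ->
  (\int[N]_x (expR (k * x ^+ 2))%:E = ((Num.sqrt (1 - 2 * k))^-1)%:E)%E.
Proof.
move=> k2; rewrite ge0_integral_normal; last 2 first.
- apply/measurable_EFinP; apply: measurableT_comp => //.
  by apply: measurable_funM => //; exact: measurable_funX.
- by move=> x; rewrite lee_fin expR_ge0.
set w := Num.sqrt _.
have w0 : 0 < w by rewrite sqrtr_gt0; lra.
have w2 : w ^+ 2 = 1 - 2 * k by rewrite sqr_sqrtr//; lra.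
transitivity (\int[lebesgue_measure]_x (w^-1%:E * (normal_pdf 0 w^-1 x)%:E))%E.
  apply: eq_integral => x _; rewrite -!EFinM; congr EFin.
  rewrite !normal_pdfE ?oner_eq0 ?invr_eq0 ?gt_eqF// /normal_fun !subr0.
  rewrite mulrCA -expRD [RHS]mulrA; congr (_ * expR _).
    rewrite /normal_peak -!mulrnAr (sqrtrM _ (sqr_ge0 w^-1)) sqrtr_sqr.
    rewrite expr1n mul1r ger0_norm ?invr_ge0 ?ltW// invfM invrK mulrA.
    by rewrite mulVf ?mul1r// gt_eqF.
  by rewrite exprVn w2; field; rewrite -w2 sqrf_eq0 gt_eqF.
rewrite ge0_integralZl//.
- by rewrite integral_normal_pdf mule1.
- by apply/measurable_EFinP; exact: measurable_normal_pdf.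
- by move=> x _; rewrite lee_fin normal_pdf_ge0.
- by rewrite lee_fin invr_ge0 ltW.
Qed.

Lemma integrable_normal_expR_sqr (k : R) : k < 2^-1 ->
  N.-integrable [set: R] (EFin \o (fun x : R => expR (k * x ^+ 2))).
Proof.
move=> k2; apply/integrableP; split.
  apply/measurable_EFinP; apply: measurableT_comp => //.
  by apply: measurable_funM => //; exact: measurable_funX.
under eq_integral do rewrite /= ger0_norm ?expR_ge0//.
by rewrite integral_normal_expR_sqr ?ltry.
Qed.

(** Polynomials of degree at most 8 are dominated by e^(x^2 / 4). *)
Lemma integrable_normal_poly (f : R -> R) (K : R) :
  measurable_fun [set: R] f -> (forall x, `|f x| <= K * (1 + x ^+ 2) ^+ 4) ->
  N.-integrable [set: R] (EFin \o f).
Proof.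
move=> mf fK.
apply: (@le_integrable _ _ _ N _ measurableT _
  (fun x => (`|K| * 16 ^+ 4)%:E * (expR (4^-1 * x ^+ 2))%:E)%E).
- exact/measurable_EFinP.
- move=> x _; rewrite -EFinM /= lee_fin [leRHS]ger0_norm; last first.
    by rewrite !mulr_ge0 ?exprn_ge0 ?expR_ge0.
  apply: (le_trans (fK x)).
  have x0 : 0 <= x ^+ 2 by exact: sqr_ge0.
  (* e^(x^2 / 4) is the fourth power of e^(x^2 / 16) >= (1 + x^2) / 16 *)
  have -> : 4^-1 * x ^+ 2 = 4%:R * (16^-1 * x ^+ 2) by field.
  rewrite expRM_natl.
  apply: (@le_trans _ _ (`|K| * (1 + x ^+ 2) ^+ 4)).
    by rewrite ler_wpM2r ?ler_norm// exprn_ge0// addr_ge0.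
  rewrite -mulrA ler_wpM2l// -exprMn ler_pXn2r ?nnegrE ?addr_ge0//.
  have := expR_ge1Dx (16^-1 * x ^+ 2); lra.
- apply: (@integrableZl _ (measurableTypeR R) R N _ measurableT).
  by apply: integrable_normal_expR_sqr; lra.
Qed.

(** Let m2 be the second moment. For |l| <= 1/4,
1 + l m2 <= E[e^(l x^2)] = (1 - 2 l)^(-1/2) <= 1 + l + 4 l^2; as l tends to 0
from both sides, this forces m2 = 1. *)
Lemma Rintegral_normal_sqr : \int[N]_x (x ^+ 2) = 1.
Proof.
set m2 := Rintegral _ _ _.
have t4 (t : R) : 0 <= t -> 1 + t <= (1 + t) ^+ 4.
  by move=> t0; rewrite -[leLHS]expr1 ler_weXn2l// lerDl.
have ip (k l : R) : N.-integrable [set: R] (EFin \o (fun x : R => k + l * x ^+ 2)).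
  apply: (@integrable_normal_poly _ (`|k| + `|l|)).
    by apply: measurable_funD => //; apply: measurable_funM => //; exact: measurable_funX.
  move=> x; have x0 := sqr_ge0 x; apply: (le_trans _ (ler_wpM2l _ (t4 _ x0))).
    rewrite (le_trans (ler_normD _ _))// normrM (ger0_norm x0).
    by have := normr_ge0 k; have := normr_ge0 l; nra.
  by rewrite addr_ge0.
have pE (k l : R) : \int[N]_x (k + l * x ^+ 2) = k + l * m2.
  rewrite (@RintegralD _ _ _ N setT (cst k) (fun x : R => l * x ^+ 2))//.
  - rewrite Rintegral_cst//= probability_setT mulr1; congr (_ + _).
    rewrite (@RintegralZl _ _ _ N setT (fun x : R => x ^+ 2))//.
    by apply: eq_integrable (ip 0 1) => // x _; rewrite /= add0r mul1r.
  - by apply: eq_integrable (ip k 0) => // x _; rewrite /= mul0r addr0.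
  - by apply: eq_integrable (ip 0 l) => // x _; rewrite /= add0r.
have key (l : R) : `|l| <= 4^-1 -> l * (m2 - 1) <= 4 * l ^+ 2.
  rewrite ler_norml => /andP[l1 l2].
  suff : 1 + l * m2 <= 1 + l + 4 * l ^+ 2 by lra.
  have w0 : 0 < 1 - 2 * l by lra.
  apply: (@le_trans _ _ (Num.sqrt (1 - 2 * l))^-1).
    rewrite -pE.
    rewrite -[leRHS]/(fine (_)%:E) -integral_normal_expR_sqr; last by lra.
    apply: le_Rintegral => //.
      by apply: integrable_normal_expR_sqr; lra.
    by move=> x _; exact: expR_ge1Dx.
  rewrite -[leLHS]mul1r ler_pdivrMr ?sqrtr_gt0//.
  have h0 : 0 <= 1 + l + 4 * l ^+ 2 by nra.
  rewrite -(@ler_pXn2r _ 2)// ?nnegrE ?mulr_ge0 ?sqrtr_ge0//.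
  rewrite exprMn (sqr_sqrtr (ltW w0)) -subr_ge0.
  have : 0 <= l ^+ 2 * (5 - 10 * l - 32 * l ^+ 3).
    rewrite mulr_ge0 ?sqr_ge0//.
    have : l ^+ 3 <= 64^-1 by nra.
    lra.
  by congr (0 <= _); ring.
apply/eqP; rewrite -subr_eq0; apply/negP => /negP d0.
set d := m2 - 1 in key d0.
have D0 : 0 < 1 + `|d| by have := normr_ge0 d; lra.
(* a value of l of the sign of d, small enough to contradict the bound *)
have /key : `|d / (8 * (1 + `|d|))| <= 4^-1.
  rewrite normrM normfV (@gtr0_norm _ (8 * _)); last by lra.
  by rewrite ler_pdivrMr; lra.
apply/negP; rewrite -ltNge.
rewrite -subr_gt0.
have -> : d / (8 * (1 + `|d|)) * d - 4 * (d / (8 * (1 + `|d|))) ^+ 2 =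
    d ^+ 2 * (1 + 2 * `|d|) / (16 * (1 + `|d|) ^+ 2).
  by field; rewrite gt_eqF.
apply: divr_gt0; last by rewrite mulr_gt0// exprn_gt0.
apply: mulr_gt0; first by rewrite exprn_even_gt0.
by have := normr_ge0 d; lra.
Qed.

(** Minus the second Hermite polynomial; the sign makes the sum of these over
the coordinates nonnegative exactly on the ball of radius sqrt n. *)
Definition onem_sqr (x : R) : R := 1 - x ^+ 2.

Lemma measurable_onem_sqr : measurable_fun [set: R] onem_sqr.
Proof. by apply: measurable_funB => //; exact: measurable_funX. Qed.

Lemma integrable_onem_sqrX k : (k <= 4)%N ->
  N.-integrable [set: R] (EFin \o (fun x : R => onem_sqr x ^+ k)).
Proof.
move=> k4; apply: (@integrable_normal_poly _ 1).
  by apply: measurable_funX; exact: measurable_onem_sqr.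
move=> x; have x0 := sqr_ge0 x.
rewrite mul1r normrX (@le_trans _ _ ((1 + x ^+ 2) ^+ k))//.
  rewrite lerXn2r ?nnegrE ?addr_ge0//.
  by rewrite (le_trans (ler_normB _ _))// normr1 (ger0_norm x0).
by rewrite ler_weXn2l// lerDl.
Qed.

Lemma Rintegral_onem_sqr : \int[N]_x onem_sqr x = 0.
Proof.
rewrite /onem_sqr (@RintegralB _ _ _ N setT (cst 1) (fun x : R => x ^+ 2))//.
- by rewrite Rintegral_cst//= probability_setT mulr1 Rintegral_normal_sqr subrr.
- by apply: eq_integrable (integrable_onem_sqrX (isT : 0 <= 4)%N).
- apply: (@integrable_normal_poly _ 1); first exact: measurable_funX.
  move=> x; rewrite ger0_norm ?sqr_ge0// mul1r; have x0 := sqr_ge0 x.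
  apply: (@le_trans _ _ (1 + x ^+ 2)); first by rewrite lerDr.
  by rewrite -[leLHS]expr1 ler_weXn2l// lerDl.
Qed.

(** For t = x^2 / 10, e^(-t) <= 1 - t + 3/4 t^2, and the right-hand side is
363/400 + 34/400 (1 - x^2) + 3/400 (1 - x^2)^2. Its integral is therefore at
least E[e^(-t)] = (6/5)^(-1/2) >= 91/100, which exceeds 363/400. *)
Lemma Rintegral_onem_sqr2_gt0 : 0 < \int[N]_x (onem_sqr x ^+ 2).
Proof.
have i1 := integrable_onem_sqrX (isT : 1 <= 4)%N.
have i2 := integrable_onem_sqrX (isT : 2 <= 4)%N.
suff : (91 / 100 : R) <= 363 / 400 + 3 / 400 * \int[N]_x (onem_sqr x ^+ 2) by lra.
have iE := @integrable_normal_expR_sqr (- 10^-1) ltac:(lra).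
have ia : N.-integrable [set: R] (EFin \o (fun x : R => 363 / 400 + 34 / 400 * onem_sqr x)).
  apply: (@integrable_normal_poly _ 1).
    apply: measurable_funD => //; apply: measurable_funM => //; exact: measurable_onem_sqr.
  move=> x; rewrite /onem_sqr; have := sqr_ge0 x; move: (x ^+ 2) => y y0.
  rewrite mul1r (@le_trans _ _ (1 + y))//.
    by rewrite ler_norml; apply/andP; split; lra.
  by rewrite -[leLHS]expr1 ler_weXn2l// lerDl.
have ib : N.-integrable [set: R] (EFin \o (fun x : R => 3 / 400 * onem_sqr x ^+ 2)).
  by apply: (@integrableZl _ (measurableTypeR R) R N _ measurableT (3 / 400) _ i2).
have <- : \int[N]_x (363 / 400 + 34 / 400 * onem_sqr x + 3 / 400 * onem_sqr x ^+ 2) =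
    363 / 400 + 3 / 400 * \int[N]_x (onem_sqr x ^+ 2).
  rewrite (@RintegralD _ _ _ N setT (fun x => 363 / 400 + 34 / 400 * onem_sqr x)
    (fun x => 3 / 400 * onem_sqr x ^+ 2))//.
  rewrite (@RintegralD _ _ _ N setT (cst (363 / 400)) (fun x => 34 / 400 * onem_sqr x))//.
  - rewrite Rintegral_cst//= probability_setT mulr1.
    rewrite (@RintegralZl _ _ _ N setT onem_sqr)// Rintegral_onem_sqr mulr0 addr0.
    by rewrite (@RintegralZl _ _ _ N setT (fun x => onem_sqr x ^+ 2)).
  - exact: finite_measure_integrable_cst.
  - by apply: (@integrableZl _ (measurableTypeR R) R N _ measurableT (34 / 400) _ i1).
apply: (@le_trans _ _ (\int[N]_x expR (- 10^-1 * x ^+ 2))).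
  rewrite -[leRHS]/(fine (\int[N]_x (expR (- 10^-1 * x ^+ 2))%:E)%E).
  rewrite integral_normal_expR_sqr/=; last by lra.
  have w0 : 0 < (1 - 2 * - 10^-1 : R) by lra.
  rewrite -[leRHS]mul1r ler_pdivlMr ?sqrtr_gt0//.
  rewrite -(@ler_pXn2r _ 2)// ?nnegrE ?mulr_ge0 ?sqrtr_ge0//.
  by rewrite exprMn (sqr_sqrtr (ltW w0)); lra.
apply: le_Rintegral => //.
  exact: (@integrableD _ (measurableTypeR R) R N _ measurableT _ _ ia ib).
move=> x _; rewrite /onem_sqr.
have : 0 <= x ^+ 2 by exact: sqr_ge0.
move: (x ^+ 2) => y y0.
have h : 0 <= 1 - 10^-1 * y + 3 / 400 * y ^+ 2 by nra.
have e1 : (1 + 20^-1 * y) ^+ 2 <= expR (10^-1 * y).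
  have -> : 10^-1 * y = 2%:R * (20^-1 * y) by field.
  rewrite expRM_natl ler_pXn2r ?nnegrE ?expR_ge0//; last by nra.
  exact: expR_ge1Dx.
rewrite mulNr expRN -[leLHS]mul1r ler_pdivrMr ?expR_gt0//.
have -> : 363 / 400 + 34 / 400 * (1 - y) + 3 / 400 * (1 - y) ^+ 2 =
    1 - 10^-1 * y + 3 / 400 * y ^+ 2 by field.
apply: (le_trans _ (ler_wpM2l h e1)).
have : 0 <= y ^+ 3 by exact: exprn_ge0.
have : 0 <= y ^+ 4 by exact: exprn_ge0.
nra.
Qed.

End normal_moments.

(** * Real integrals on probability spaces *)

Section Rintegral_facts.
Context d (T : measurableType d) (R : realType) (P : probability T R).
Implicit Types f g : T -> R.

Lemma EFin_Rintegral f : P.-integrable [set: T] (EFin \o f) ->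
  (\int[P]_x f x)%:E = (\int[P]_x (f x)%:E)%E.
Proof. by move=> intf; rewrite fineK//; exact: integrable_fin_num. Qed.

Lemma integrable_bounded f (M : R) : measurable_fun [set: T] f ->
  (forall x, `|f x| <= M) -> P.-integrable [set: T] (EFin \o f).
Proof.
move=> mf fM.
apply: (@le_integrable _ _ _ P _ measurableT _ (cst M%:E)).
- exact/measurable_EFinP.
- move=> x _; rewrite /= lee_fin.
  by rewrite (le_trans (fM x))// ler_norm.
- exact: finite_measure_integrable_cst.
Qed.

Lemma Rintegral_Cauchy_Schwarz f g :
  P.-integrable [set: T] (EFin \o (fun x => f x ^+ 2)) ->
  P.-integrable [set: T] (EFin \o (fun x => g x ^+ 2)) ->
  P.-integrable [set: T] (EFin \o (fun x => f x * g x)) ->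
  (\int[P]_x (f x * g x)) ^+ 2 <= \int[P]_x (f x ^+ 2) * \int[P]_x (g x ^+ 2).
Proof.
move=> iff igg ifg; set b := Rintegral _ _ (fun x => f x * g x).
set a := Rintegral _ _ _; set c := Rintegral _ _ _.
have c0 : 0 <= c by apply: Rintegral_ge0 => x _; exact: sqr_ge0.
have a0 : 0 <= a by apply: Rintegral_ge0 => x _; exact: sqr_ge0.
have key l : 0 <= a - 2 * l * b + l ^+ 2 * c.
  have ib : P.-integrable [set: T] (EFin \o (fun x => 2 * l * (f x * g x))).
    exact: (@integrableZl _ _ _ P _ measurableT (2 * l) _ ifg).
  have ic : P.-integrable [set: T] (EFin \o (fun x => l ^+ 2 * g x ^+ 2)).
    exact: (@integrableZl _ _ _ P _ measurableT (l ^+ 2) _ igg).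
  rewrite -(@RintegralZl _ _ _ P setT _ (2 * l) _ ifg)//.
  rewrite -(@RintegralZl _ _ _ P setT _ (l ^+ 2) _ igg)//.
  rewrite -(@RintegralB _ _ _ P setT)//.
  rewrite -(@RintegralD _ _ _ P setT)//; last first.
    exact: (@integrableB _ _ _ P _ measurableT _ _ iff ib).
  apply: Rintegral_ge0 => x _ /=.
  have -> : f x ^+ 2 - 2 * l * (f x * g x) + l ^+ 2 * g x ^+ 2 = (f x - l * g x) ^+ 2.
    by ring.
  exact: sqr_ge0.
have [c00|cn0] := eqVneq c 0.
  have [->|bn0] := eqVneq b 0; first by rewrite expr0n mulr_ge0.
  (* the quadratic polynomial is then affine: a value of l that makes it -1 *)
  have := key ((a + 1) / (2 * b)).
  have -> : a - 2 * ((a + 1) / (2 * b)) * b + ((a + 1) / (2 * b)) ^+ 2 * c = - 1.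
    by rewrite c00; field.
  by rewrite oppr_ge0 ler10.
have cp : 0 < c by rewrite lt_neqAle eq_sym cn0.
(* the minimizer of the quadratic polynomial *)
have := key (b / c).
have -> : a - 2 * (b / c) * b + (b / c) ^+ 2 * c = (a * c - b ^+ 2) / c by field.
by rewrite pmulr_lge0 ?invr_gt0// subr_ge0.
Qed.

Lemma integrable_sumR (I : finType) (f : I -> T -> R) :
  (forall i, P.-integrable [set: T] (EFin \o f i)) ->
  P.-integrable [set: T] (EFin \o (fun x => \sum_i f i x)).
Proof.
move=> intf; rewrite (_ : _ \o _ = fun x => (\sum_i (f i x)%:E)%E); last first.
  by apply/funext => x /=; rewrite sumEFin.
by apply: (@integrable_sum _ _ _ P _ measurableT) => i _; exact: intf.
Qed.

Lemma Rintegral_sum (I : finType) (f : I -> T -> R) :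
  (forall i, P.-integrable [set: T] (EFin \o f i)) ->
  \int[P]_x (\sum_i f i x) = \sum_i \int[P]_x f i x.
Proof.
move=> intf; apply: EFin_inj; rewrite EFin_Rintegral; last exact: integrable_sumR.
rewrite -sumEFin; under [RHS]eq_bigr do rewrite EFin_Rintegral//.
rewrite -(@integral_sum _ _ _ P _ measurableT)//.
by apply: eq_integral => x _; rewrite sumEFin.
Qed.

End Rintegral_facts.

Section tensor.
Context d1 d2 (T1 : measurableType d1) (T2 : measurableType d2) (R : realType).
Variables (P1 : probability T1 R) (P2 : probability T2 R).
Variables (f : T1 -> R) (g : T2 -> R).
Hypothesis intf : P1.-integrable [set: T1] (EFin \o f).
Hypothesis intg : P2.-integrable [set: T2] (EFin \o g).

Lemma integrable_tensor :
  (P1 \x P2)%E.-integrable [set: T1 * T2] (EFin \o (fun z => f z.1 * g z.2)).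
Proof.
have mf : measurable_fun [set: T1] f by exact/measurable_EFinP/(measurable_int _ intf).
have mg : measurable_fun [set: T2] g by exact/measurable_EFinP/(measurable_int _ intg).
apply/integrable12ltyP.
  by apply/measurable_EFinP; apply: measurable_funM; exact: measurableT_comp.
rewrite /= (eq_integral (fun x => `|(f x)%:E| * \int[P2]_y `|(g y)%:E|)%E).
  rewrite ge0_integralZr//.
  - have /integrableP[_ f_oo] := intf; have /integrableP[_ g_oo] := intg.
    by rewrite lte_mul_pinfty ?integral_ge0// ge0_fin_numE ?integral_ge0.
  - by apply: measurableT_comp => //; exact/measurable_EFinP.
  - exact: integral_ge0.
move=> x _; rewrite -ge0_integralZl//.
- by apply: eq_integral => y _; rewrite normrM EFinM.
- by apply: measurableT_comp => //; exact/measurable_EFinP.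
Qed.

Lemma Rintegral_tensor :
  \int[(P1 \x P2)%E]_z (f z.1 * g z.2) = \int[P1]_x f x * \int[P2]_y g y.
Proof.
rewrite {1}/Rintegral -(integral12_prod_meas1 integrable_tensor)/=.
rewrite (eq_integral (fun x => (f x)%:E * (\int[P2]_y g y)%:E)%E).
  by rewrite integralZr// -EFin_Rintegral//.
move=> x _; rewrite EFin_Rintegral// -integralZl//.
Qed.

End tensor.

(** * Sums over the coordinates of a Gaussian vector *)

Section coord_sum.
Context {R : realType}.
Local Notation N := (normal_prob (0 : R) 1).
Local Notation gauss := (gauss R).

Lemma integrable_Rintegral_gaussS n (H : n.+1.-tuple R -> R) (K : R * n.-tuple R -> R) :
  measurable_fun [set: n.+1.-tuple R] H -> (forall z, H (cons_fun z) = K z) ->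
  (N \x gauss n)%E.-integrable setT (EFin \o K) ->
  (gauss n.+1).-integrable setT (EFin \o H) /\
  \int[gauss n.+1]_x H x = \int[(N \x gauss n)%E]_z K z.
Proof.
move=> mH HK iK.
have mHE : measurable_fun [set: n.+1.-tuple R] (EFin \o H) by exact/measurable_EFinP.
have EK : (EFin \o H) \o @cons_fun R n = EFin \o K.
  by apply/funext => z /=; rewrite HK.
split; last first.
  rewrite /Rintegral; congr fine.
  rewrite [LHS](@integral_distribution _ _ _ _ _ (N \x gauss n)%E _ (EFin \o H)).
  - by apply: eq_integral => z _ /=; rewrite HK.
  - exact: mHE.
  - by have := iK; rewrite -EK.
apply/integrableP; split; first exact: mHE.
rewrite (@ge0_integral_distribution _ _ _ _ _ (N \x gauss n)%E)//; last first.
  by apply: measurableT_comp.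
have /integrableP[_] := iK; congr (_ < _)%E.
by apply: eq_integral => z _ /=; rewrite HK.
Qed.

Definition coord_sum (psi : R -> R) n (x : n.-tuple R) : R := \sum_(i < n) psi (tnth x i).

Lemma coord_sum_cons psi n (z : R * n.-tuple R) :
  coord_sum psi (cons_fun z) = psi z.1 + coord_sum psi z.2.
Proof.
rewrite /coord_sum big_ord_recl; congr (_ + _).
by apply: eq_bigr => i _; rewrite tnth_cons_funS.
Qed.

Lemma measurable_coord_sum psi n : measurable_fun [set: R] psi ->
  measurable_fun [set: n.-tuple R] (@coord_sum psi n).
Proof.
move=> mpsi; apply: measurable_sum => i.
by apply: measurableT_comp => //; exact: measurable_tnth.
Qed.

(** The coordinates are independent and psi is centered, so in the expansion of
the fourth power of the sum only the terms psi(x_i)^4 and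
psi(x_i)^2 psi(x_j)^2 contribute. *)
Lemma coord_sum_moments (psi : R -> R) (v w : R) n :
  measurable_fun [set: R] psi ->
  (forall k, (k <= 4)%N -> N.-integrable [set: R] (EFin \o (fun x => psi x ^+ k))) ->
  \int[N]_x psi x = 0 -> \int[N]_x (psi x ^+ 2) = v -> \int[N]_x (psi x ^+ 4) = w ->
  [/\ forall k, (k <= 4)%N ->
        (gauss n).-integrable setT (EFin \o (fun x => coord_sum psi x ^+ k)),
      \int[gauss n]_x coord_sum psi x = 0,
      \int[gauss n]_x (coord_sum psi x ^+ 2) = n%:R * v &
      \int[gauss n]_x (coord_sum psi x ^+ 4) <= n%:R ^+ 2 * (w + 3 * v ^+ 2) ].
Proof.
move=> mpsi ipsi psi1 psi2 psi4; elim: n => [|n [iS S1 S2 S4]].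
  have S0 (x : 0.-tuple R) : coord_sum psi x = 0 by rewrite /coord_sum big_ord0.
  split.
  - move=> k _; apply: (@integrable_bounded _ _ _ (gauss 0) _ (`|0 ^+ k|)).
      by apply: measurable_funX; exact: measurable_coord_sum.
    by move=> x; rewrite S0.
  - under eq_Rintegral do rewrite S0.
    by rewrite Rintegral_cst//= mul0r.
  - under eq_Rintegral do rewrite S0 expr0n/=.
    by rewrite Rintegral_cst//= !mul0r.
  - under eq_Rintegral do rewrite S0 expr0n/=.
    by rewrite Rintegral_cst//= expr0n !mul0r.
have iPS k j : (k <= 4)%N -> (j <= 4)%N -> (N \x gauss n)%E.-integrable setT
    (EFin \o (fun z => psi z.1 ^+ k * coord_sum psi z.2 ^+ j)).
  move=> k4 j4; apply: (@integrable_tensor _ _ _ _ R N (gauss n)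
    (fun x => psi x ^+ k) (fun y => coord_sum psi y ^+ j)).
    exact: ipsi.
  exact: iS.
have iT k (i : 'I_k.+1) : (k <= 4)%N -> (N \x gauss n)%E.-integrable setT
    (EFin \o (fun z => 'C(k, i)%:R * (psi z.1 ^+ (k - i) * coord_sum psi z.2 ^+ i))).
  move=> k4; apply: (@integrableZl _ _ _ (N \x gauss n)%E _ measurableT 'C(k, i)%:R _
    (iPS (k - i)%N i _ _)).
    by rewrite (leq_trans _ k4)// leq_subr.
  by rewrite (leq_trans _ k4)// -ltnS.
have binom k (z : R * n.-tuple R) : coord_sum psi (cons_fun z) ^+ k =
    \sum_(i < k.+1) 'C(k, i)%:R * (psi z.1 ^+ (k - i) * coord_sum psi z.2 ^+ i).
  by rewrite coord_sum_cons exprDn; apply: eq_bigr => i _; rewrite mulr_natl.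
have step k : (k <= 4)%N ->
  (gauss n.+1).-integrable setT (EFin \o (fun x => coord_sum psi x ^+ k)) /\
  \int[gauss n.+1]_x (coord_sum psi x ^+ k) =
  \sum_(i < k.+1) 'C(k, i)%:R *
     (\int[N]_x (psi x ^+ (k - i)) * \int[gauss n]_y (coord_sum psi y ^+ i)).
  move=> k4.
  have [||iH ->] := @integrable_Rintegral_gaussS n (fun x => coord_sum psi x ^+ k) _ _ (binom k).
  - by apply: measurable_funX; exact: measurable_coord_sum.
  - apply: (@integrable_sumR _ _ _ (N \x gauss n)%E) => i; exact: iT.
  split => //; rewrite (@Rintegral_sum _ _ _ (N \x gauss n)%E); last by move=> i; exact: iT.
  apply: eq_bigr => i _.
  have ki : (k - i <= 4)%N by rewrite (leq_trans _ k4)// leq_subr.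
  have i4 : (i <= 4)%N by rewrite (leq_trans _ k4)// -ltnS.
  rewrite (@RintegralZl _ _ _ (N \x gauss n)%E setT _ _ measurableT (iPS _ _ ki i4)).
  congr (_ * _).
  exact: (@Rintegral_tensor _ _ _ _ R N (gauss n)
    (fun x => psi x ^+ (k - i)) (fun y => coord_sum psi y ^+ i) (ipsi _ ki) (iS _ i4)).
have one d (T : measurableType d) (P : probability T R) (f : T -> R) :
    \int[P]_x (f x ^+ 0) = 1.
  by under eq_Rintegral do rewrite expr0; rewrite Rintegral_cst//= probability_setT mulr1.
have expr1E d (T : measurableType d) (P : probability T R) (f : T -> R) :
    \int[P]_x (f x ^+ 1) = \int[P]_x f x.
  by [].
split.
- by move=> k /step[].
- have [//|_] := step 1%N; rewrite expr1E => ->.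
  rewrite !big_ord_recl big_ord0 /= !one !expr1E psi1 S1.
  by rewrite /bump /= !mulr0 ?mul0r !addr0 mulr0.
- have [//|_ ->] := step 2%N.
  rewrite !big_ord_recl big_ord0 /= /bump/= !one !expr1E psi1 psi2 S1 S2.
  rewrite (_ : 'C(2, 0) = 1%N)// (_ : 'C(2, 1 + (1 + 0)) = 1%N)// -natr1.
  by ring.
- have [//|_ ->] := step 4%N.
  rewrite !big_ord_recl big_ord0 /= /bump/= !one !expr1E psi1 psi2 psi4 S1 S2.
  rewrite (_ : 'C(4, 0) = 1%N)// (_ : 'C(4, 1 + (1 + 0)) = 6%N)//.
  rewrite (_ : 'C(4, 1 + (1 + (1 + (1 + 0)))) = 1%N)//.
  rewrite !mul0r !mulr0 !mulr1 !mul1r addr0 !add0r.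
  have w0 : 0 <= w.
    by rewrite -psi4; apply: Rintegral_ge0 => x _; rewrite exprn_even_ge0.
  apply: (@le_trans _ _ (w + (6 * (v * (n%:R * v)) + n%:R ^+ 2 * (w + 3 * v ^+ 2)))).
    by rewrite !lerD2l.
  rewrite -natr1 -subr_ge0 (_ : _ - _ = 2 * n%:R * w + 3 * v ^+ 2); last by ring.
  by apply: addr_ge0; apply: mulr_ge0; rewrite ?sqr_ge0// mulr_ge0.
Qed.

End coord_sum.

(** * Covariance of the ball with half-spaces *)

Section halfspace_covariance.
Context {R : realType}.
Local Notation N := (normal_prob (0 : R) 1).
Local Notation gauss := (gauss R).

Lemma covariance_bounded d (T : measurableType d) (P : probability T R)
    (f g : T -> R) (M : R) :
  measurable_fun [set: T] f -> measurable_fun [set: T] g ->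
  (forall x, `|f x| <= M) -> (forall x, `|g x| <= M) ->
  covariance P f g =
  (\int[P]_x (f x * g x) - (\int[P]_x f x) * (\int[P]_x g x))%:E.
Proof.
move=> mf mg fM gM.
have intf := integrable_bounded P mf fM.
have intg := integrable_bounded P mg gM.
have intfg : P.-integrable setT (EFin \o (f * g)).
  apply: (@integrable_bounded _ _ _ P _ (M * M)).
    exact: measurable_funM.
  by move=> x; rewrite normrM ler_pM.
rewrite covarianceE; [|exact/Lfun1_integrable..].
by rewrite unlock EFinB EFinM !EFin_Rintegral.
Qed.

Lemma sqrt_ballE n (x : n.-tuple R) : sqrt_ball R n x <-> dotp x x <= n%:R.
Proof.
rewrite /sqrt_ball /eball/= /enorm; have [x0|x0] := leP (dotp x x) 0.
  by rewrite ler0_sqrtr// sqrtr_ge0; split => // _; rewrite (le_trans x0).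
by rewrite ler_sqrt.
Qed.

Lemma sqrt_ball_indicE n (x : n.-tuple R) :
  \1_(sqrt_ball R n) x = (dotp x x <= n%:R)%R%:R :> R.
Proof.
rewrite indicE; congr (_%:R); congr nat_of_bool.
by apply/idP/idP; rewrite inE => /sqrt_ballE.
Qed.

Lemma half_space_indicE n (a x : n.-tuple R) b :
  \1_(half_space a b) x = (dotp x a <= b)%R%:R :> R.
Proof.
rewrite indicE; congr (_%:R); congr nat_of_bool.
by apply/idP/idP; rewrite inE.
Qed.

Lemma measurable_le_indic d (T : measurableType d) (f : T -> R) (b : R) :
  measurable_fun [set: T] f -> measurable_fun [set: T] (fun x => (f x <= b)%R%:R : R).
Proof.
move=> mf; rewrite (_ : (fun x => _) = \1_(f @^-1` `]-oo, b])).
  apply: measurable_indic; rewrite -[_ @^-1` _]setTI.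
  exact: mf.
apply/funext => x; rewrite indicE; congr (_%:R); congr nat_of_bool.
by apply/idP/idP; rewrite inE/= in_itv.
Qed.

Lemma norm_indic_le1 (b : bool) : `|b%:R : R| <= 1.
Proof. by case: b; rewrite /= ?normr1 ?normr0. Qed.

Lemma Rintegral_gauss_direction n (a b : n.-tuple R) (F : R * R -> R) :
  dotp a a = dotp b b -> measurable_fun [set: R * R] F -> (forall z, 0 <= F z) ->
  \int[gauss n]_x F (dotp x a, dotp x x) = \int[gauss n]_x F (dotp x b, dotp x x).
Proof.
move=> ab mF F0; rewrite /Rintegral; congr fine.
apply: (@ge0_integral_gauss_direction R n a b (EFin \o F)) => //.
exact/measurable_EFinP.
Qed.

Lemma measurable_sqrt_ball_indic n :
  measurable_fun [set: n.-tuple R] (\1_(sqrt_ball R n) : n.-tuple R -> R).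
Proof.
rewrite (_ : \1__ = fun x => (dotp x x <= n%:R)%R%:R); last first.
  by apply/funext => x; exact: sqrt_ball_indicE.
by apply: measurable_le_indic; exact: measurable_dotp.
Qed.

Definition scaled_delta n (r : R) (i : 'I_n) : n.-tuple R :=
  [tuple r * (j == i)%:R | j < n].

Lemma dotp_scaled_delta n r (i : 'I_n) (x : n.-tuple R) :
  dotp x (scaled_delta r i) = r * tnth x i.
Proof.
rewrite /dotp (bigD1 i)//= big1 ?addr0; first by rewrite tnth_mktuple eqxx mulr1 mulrC.
by move=> j /negPf ji; rewrite tnth_mktuple ji !mulr0.
Qed.

(** By rotation invariance the covariance is that of the ball with each
half-space {|a| x_i <= b}. The indicators of the latter are independent, so
their centered sum has second moment at most n, and the Cauchy-Schwarz
inequality bounds n times the covariance by sqrt n. *)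
Lemma covariance_half_space_le n (a : n.-tuple R) (b : R) : (0 < n)%N ->
  (covariance (gauss n) \1_(half_space a b) \1_(sqrt_ball R n) <=
   (n%:R `^ (- 2^-1))%:E)%E.
Proof.
move=> n0.
pose f x : R := \1_(sqrt_ball R n) x.
have fE x : f x = (dotp x x <= n%:R)%R%:R by exact: sqrt_ball_indicE.
have mf : measurable_fun [set: n.-tuple R] f by exact: measurable_sqrt_ball_indic.
pose r := Num.sqrt (dotp a a).
pose h (u : R) : R := (r * u <= b)%R%:R.
have mh : measurable_fun [set: R] h.
  by apply: measurable_le_indic; exact: measurable_funM.
pose A x : R := \1_(half_space a b) x.
have mA : measurable_fun [set: n.-tuple R] A.
  rewrite (_ : A = fun x => (dotp x a <= b)%R%:R).
    by apply: measurable_le_indic; exact: measurable_dotp.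
  by apply/funext => x; exact: half_space_indicE.
have f1 x : `|f x| <= 1 by rewrite fE norm_indic_le1.
have A1 x : `|A x| <= 1 by rewrite /A half_space_indicE norm_indic_le1.
have h1 x : `|h x| <= 1 by exact: norm_indic_le1.
rewrite (covariance_bounded (gauss n) mA mf A1 f1) lee_fin.
set c := (X in X <= _).
have same (i : 'I_n) : dotp a a = dotp (scaled_delta r i) (scaled_delta r i).
  by rewrite dotp_scaled_delta tnth_mktuple eqxx mulr1 -expr2 sqr_sqrtr// dotpxx_ge0.
have EA (i : 'I_n) : \int[gauss n]_x h (tnth x i) = \int[gauss n]_x A x.
  transitivity (\int[gauss n]_x (dotp x (scaled_delta r i) <= b)%R%:R).
    by apply: eq_Rintegral => x _; rewrite dotp_scaled_delta.
  rewrite -(Rintegral_gauss_direction (F := fun z => (z.1 <= b)%R%:R) (same i))//.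
    by apply: eq_Rintegral => x _; rewrite /A half_space_indicE.
  by apply: measurable_le_indic; exact: measurable_fst.
have EAf (i : 'I_n) : \int[gauss n]_x (h (tnth x i) * f x) = \int[gauss n]_x (A x * f x).
  pose F (z : R * R) : R := (z.1 <= b)%R%:R * (z.2 <= n%:R)%R%:R.
  transitivity (\int[gauss n]_x F (dotp x (scaled_delta r i), dotp x x)).
    by apply: eq_Rintegral => x _; rewrite fE dotp_scaled_delta.
  rewrite -(Rintegral_gauss_direction (F := F) (same i)).
  - by apply: eq_Rintegral => x _; rewrite /A half_space_indicE fE.
  - apply: measurable_funM; apply: measurable_le_indic.
      exact: measurable_fst.
    exact: measurable_snd.
  - by move=> z; rewrite mulr_ge0.
pose p := \int[N]_u h u.
pose psi u := h u - p.
have mpsi : measurable_fun [set: R] psi by exact: measurable_funB.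
have ih := integrable_bounded N mh h1.
have p01 : 0 <= p <= 1.
  apply/andP; split; first by apply: Rintegral_ge0 => u _; rewrite /h.
  apply: (@le_trans _ _ (\int[N]_u (cst 1 u))).
    apply: le_Rintegral => //; first exact: finite_measure_integrable_cst.
    by move=> u _; rewrite (le_trans (ler_norm _)).
  by rewrite Rintegral_cst//= probability_setT mulr1.
have psi1 u : `|psi u| <= 1.
  rewrite ler_norml /psi /h; case: (r * u <= b); move: p01 => /andP[p0 p1];
  by rewrite ?mulr1n ?mulr0n; apply/andP; split; lra.
have ipsi k : N.-integrable [set: R] (EFin \o (fun u => psi u ^+ k)).
  apply: (@integrable_bounded _ _ _ N _ 1); first exact: measurable_funX.
  by move=> u; rewrite normrX exprn_ile1.
have Epsi : \int[N]_u psi u = 0.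
  rewrite (@RintegralB _ _ _ N setT h (cst p))//.
    by rewrite Rintegral_cst//= probability_setT mulr1 subrr.
  exact: finite_measure_integrable_cst.
have [iS S1 S2 _] := @coord_sum_moments R psi _ _ n mpsi (fun k _ => ipsi k) Epsi erefl erefl.
have npos : 0 < n%:R :> R by rewrite ltr0n.
have mti (i : 'I_n) : measurable_fun [set: n.-tuple R] (fun x => tnth x i).
  exact: measurable_tnth.
have ihi (i : 'I_n) : (gauss n).-integrable setT (EFin \o (fun x => h (tnth x i))).
  by apply: (@integrable_bounded _ _ _ (gauss n) _ 1) => //; exact: measurableT_comp.
have ip : (gauss n).-integrable setT (EFin \o (cst p : n.-tuple R -> R)).
  exact: finite_measure_integrable_cst.
(* the one-dimensional mean p is the measure of the half-space, because the
   centered sum has mean 0 *)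
have pA : \int[gauss n]_x A x = p.
  have : \int[gauss n]_x coord_sum psi x = n%:R * (\int[gauss n]_x A x - p).
    rewrite (@Rintegral_sum _ _ _ (gauss n) _ (fun i x => psi (tnth x i))).
      rewrite (eq_bigr (fun=> \int[gauss n]_x A x - p)) => [|i _].
        by rewrite sumr_const card_ord mulr_natl.
      rewrite (@RintegralB _ _ _ (gauss n) setT (fun x => h (tnth x i)) (cst p))//.
      by rewrite EA Rintegral_cst//= probability_setT mulr1.
    move=> i; apply: (@integrable_bounded _ _ _ (gauss n) _ 1) => //.
    exact: measurableT_comp.
  by rewrite S1 => /esym/eqP; rewrite mulf_eq0 gt_eqF//= subr_eq0 => /eqP.
have intf := integrable_bounded (gauss n) mf f1.
have key : \int[gauss n]_x (coord_sum psi x * f x) = n%:R * c.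
  under eq_Rintegral do rewrite mulr_suml.
  rewrite (@Rintegral_sum _ _ _ (gauss n) _ (fun i x => psi (tnth x i) * f x)).
    rewrite (eq_bigr (fun=> c)) => [|i _]; first by rewrite sumr_const card_ord mulr_natl.
    rewrite /c pA -(EAf i) -(@RintegralZl _ _ _ (gauss n) setT _ p measurableT intf).
    rewrite -(@RintegralB _ _ _ (gauss n) setT).
    - by apply: eq_Rintegral => x _; rewrite /= mulrBl.
    - exact: measurableT.
    - apply: (@integrable_bounded _ _ _ (gauss n) _ 1).
        by apply: measurable_funM => //; exact: measurableT_comp.
      by move=> x; rewrite normrM mulr_ile1.
    - exact: (@integrableZl _ _ _ (gauss n) _ measurableT p _ intf).
  move=> i; apply: (@integrable_bounded _ _ _ (gauss n) _ 1).
    by apply: measurable_funM => //; exact: measurableT_comp.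
  by move=> x; rewrite normrM mulr_ile1.
have int1 d (T : measurableType d) (P : probability T R) (g : T -> R) :
    measurable_fun [set: T] g -> (forall x, `|g x| <= 1) -> \int[P]_x (g x ^+ 2) <= 1.
  move=> mg g1; apply: (@le_trans _ _ (\int[P]_x (cst 1 x))); last first.
    by rewrite Rintegral_cst//= probability_setT mulr1.
  apply: le_Rintegral => //.
  - apply: (@integrable_bounded _ _ _ P _ 1); first exact: measurable_funX.
    by move=> x; rewrite normrX exprn_ile1.
  - exact: finite_measure_integrable_cst.
  - by move=> x _; rewrite -real_normK ?num_real// exprn_ile1.
have iff : (gauss n).-integrable setT (EFin \o (fun x => f x ^+ 2)).
  apply: (@integrable_bounded _ _ _ (gauss n) _ 1); first exact: measurable_funX.
  by move=> x; rewrite normrX exprn_ile1.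
have iSf : (gauss n).-integrable setT (EFin \o (fun x => coord_sum psi x * f x)).
  apply: (@le_integrable _ _ _ (gauss n) _ measurableT _
    (EFin \o (fun x => coord_sum psi x ^+ 1))).
  - by apply/measurable_EFinP; apply: measurable_funM => //; exact: measurable_coord_sum.
  - by move=> x _; rewrite /= lee_fin normrM expr1 ler_piMr.
  - exact: iS.
have := Rintegral_Cauchy_Schwarz (iS 2%N isT) iff iSf.
rewrite key S2 => CS.
have nc : n%:R * c ^+ 2 <= 1.
  have v1 := int1 _ _ N psi mpsi psi1.
  have e1 := int1 _ _ (gauss n) f mf f1.
  have v0 : 0 <= \int[N]_u (psi u ^+ 2) by apply: Rintegral_ge0 => u _; exact: sqr_ge0.
  have e0 : 0 <= \int[gauss n]_x (f x ^+ 2) by apply: Rintegral_ge0 => u _; exact: sqr_ge0.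
  rewrite -(ler_pM2l npos) mulr1 mulrA -expr2 -exprMn (le_trans CS)//.
  by rewrite -mulrA ler_piMr ?ler0n// mulr_ile1.
rewrite powRN powR12_sqrt//.
have [c0|c0] := leP c 0; first by rewrite (le_trans c0)// invr_ge0 sqrtr_ge0.
rewrite -[leRHS]mul1r ler_pdivlMr ?sqrtr_gt0//.
rewrite -(@ler_pXn2r _ 2)// ?nnegrE ?mulr_ge0 ?sqrtr_ge0 ?(ltW c0)//.
by rewrite exprMn sqr_sqrtr ?ler0n// expr1n mulrC.
Qed.

Lemma maxcov_sqrt_ball_le n : (0 < n)%N ->
  (maxcov (sqrt_ball R n) <= (n%:R `^ (- 2^-1))%:E)%E.
Proof.
move=> n0; apply: ge_ereal_sup => _ [A [a [b ->]] <-].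
exact: covariance_half_space_le.
Qed.

End halfspace_covariance.

(** * The Ornstein-Uhlenbeck semigroup and the second chaos *)

Section mehler_formula.
Context {R : realType}.
Local Notation N := (normal_prob (0 : R) 1).
Local Notation gauss := (gauss R).

Lemma integrable_normal_affine_sqr (a b : R) :
  N.-integrable [set: R] (EFin \o (fun x => (a + b * x) ^+ 2)).
Proof.
apply: (@integrable_normal_poly _ _ (2 * a ^+ 2 + 2 * b ^+ 2)).
  by apply: measurable_funX; apply: measurable_funD => //; exact: measurable_funM.
move=> x; rewrite ger0_norm ?sqr_ge0//.
have x0 := sqr_ge0 x; have a0 := sqr_ge0 a; have b0 := sqr_ge0 b.
apply: (@le_trans _ _ ((2 * a ^+ 2 + 2 * b ^+ 2) * (1 + x ^+ 2))).
  rewrite -subr_ge0.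
  have -> : (2 * a ^+ 2 + 2 * b ^+ 2) * (1 + x ^+ 2) - (a + b * x) ^+ 2 =
      (a - b * x) ^+ 2 + 2 * (b ^+ 2 + a ^+ 2 * x ^+ 2) by ring.
  by rewrite addr_ge0 ?sqr_ge0// mulr_ge0// addr_ge0// mulr_ge0.
apply: ler_wpM2l; first by rewrite addr_ge0// mulr_ge0.
by rewrite -[leLHS]expr1 ler_weXn2l// lerDl.
Qed.

(** By the symmetry of the normal law the cross term cancels between b and
- b. *)
Lemma Rintegral_normal_affine_sqr (a b : R) :
  \int[N]_x ((a + b * x) ^+ 2) = a ^+ 2 + b ^+ 2.
Proof.
have iab k := integrable_normal_affine_sqr a k.
have sym : \int[N]_x ((a + - b * x) ^+ 2) = \int[N]_x ((a + b * x) ^+ 2).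
  rewrite /Rintegral; congr fine.
  rewrite -(@ge0_integral_normalN R (fun x => ((a + b * x) ^+ 2)%:E)).
  - by apply: eq_integral => x _; rewrite mulrN mulNr.
  - exact: measurable_int (iab b).
  - by move=> x; rewrite lee_fin sqr_ge0.
have i1 := integrable_onem_sqrX (R := R) (isT : 1 <= 4)%N.
have i1' := @integrableZl _ (measurableTypeR R) R N _ measurableT (2 * b ^+ 2) _ i1.
suff : \int[N]_x ((a + b * x) ^+ 2) + \int[N]_x ((a + - b * x) ^+ 2) = 2 * (a ^+ 2 + b ^+ 2).
  by rewrite sym; move: (Rintegral _ _ _) => I; lra.
rewrite -(@RintegralD _ _ _ N setT _ _ measurableT (iab b) (iab (- b))).
transitivity (\int[N]_x (cst (2 * (a ^+ 2 + b ^+ 2)) x - 2 * b ^+ 2 * onem_sqr x)).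
  by apply: eq_Rintegral => x _; rewrite /onem_sqr /=; ring.
rewrite (@RintegralB _ _ _ N setT (cst _) (fun x => 2 * b ^+ 2 * onem_sqr x))//.
  rewrite (@RintegralZl _ _ _ N setT onem_sqr _ measurableT i1) Rintegral_onem_sqr mulr0 subr0.
  by rewrite Rintegral_cst//= probability_setT mulr1.
exact: finite_measure_integrable_cst.
Qed.

Lemma integral_gauss_lincomb_dotp n (a b : R) (u : n.-tuple R) :
  (\int[gauss n]_v (dotp (lincomb a b u v) (lincomb a b u v))%:E =
   (a ^+ 2 * dotp u u + b ^+ 2 * n%:R)%:E)%E.
Proof.
elim: n u => [|n IHn] u.
  under eq_integral do rewrite /dotp big_ord0.
  by rewrite integral_cst//= mul0e /dotp big_ord0 !mulr0 addr0.
have [[u0 u'] ->] := cons_funP u.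
have mq m (w : m.-tuple R) : measurable_fun [set: m.-tuple R]
    (fun v => (dotp (lincomb a b w v) (lincomb a b w v))%:E).
  apply/measurable_EFinP; apply: measurable_dotp; exact: measurable_lincomb.
rewrite ge0_integral_gaussS//; last by move=> v; rewrite lee_fin dotpxx_ge0.
have iab := integrable_normal_affine_sqr (a * u0) b.
transitivity (\int[N]_x (((a * u0 + b * x) ^+ 2)%:E +
    (a ^+ 2 * dotp u' u' + b ^+ 2 * n%:R)%:E))%E.
  apply: eq_integral => x _.
  under eq_integral do rewrite lincomb_cons_fun dotp_cons_fun/= EFinD -expr2.
  rewrite ge0_integralD//.
  - by rewrite integral_cst//= probability_setT mule1 IHn.
  - by move=> v _; rewrite lee_fin sqr_ge0.
  - by move=> v _; rewrite lee_fin dotpxx_ge0.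
  - exact: mq.
have ic : N.-integrable [set: R] (EFin \o (cst (a ^+ 2 * dotp u' u' + b ^+ 2 * n%:R))).
  exact: finite_measure_integrable_cst.
transitivity (\int[N]_x ((EFin \o (fun x : R => ((a * u0 + b * x) ^+ 2)%R)) x +
    (EFin \o cst (a ^+ 2 * dotp u' u' + b ^+ 2 * n%:R)%R) x))%E; first by [].
rewrite (@integralD _ _ _ N _ measurableT _ _ iab ic).
rewrite -(EFin_Rintegral iab) Rintegral_normal_affine_sqr.
rewrite -(EFin_Rintegral ic) Rintegral_cst//= probability_setT mulr1.
rewrite -EFinD dotp_cons_fun/= -natr1; congr EFin.
by ring.
Qed.

Section mehler.
Variables (n : nat) (rho sigma : R).
Hypothesis rs1 : rho ^+ 2 + sigma ^+ 2 = 1.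
Variable f : n.-tuple R -> R.
Hypothesis mf : measurable_fun [set: n.-tuple R] f.
Hypothesis f0 : forall x, 0 <= f x.

Local Open Scope ereal_scope.

(** The Gaussian measure is invariant under the semigroup. *)
Lemma integral_mehler :
  \int[gauss n]_x \int[gauss n]_y (f (lincomb rho sigma x y))%:E =
  \int[gauss n]_x (f x)%:E.
Proof.
transitivity (\int[gauss n]_x \int[gauss n]_y (EFin \o f \o fst)
  (lincomb rho sigma x y, lincomb (- sigma)%R rho x y)).
  by [].
rewrite (@ge0_integral_gauss_rotation R n _ _ (EFin \o f \o fst) rs1).
- apply: eq_integral => x _.
  rewrite -[RHS]mule1 -(probability_setT (gauss n)).
  exact: (@integral_cst _ _ _ (gauss n) _ measurableT (f x)%:E).
- by apply/measurable_EFinP; exact: measurableT_comp.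
- by move=> z; rewrite lee_fin.
Qed.

(** Rotating (X, Y) moves the noise from the argument of f to |X|^2, which
becomes |rho U - sigma V|^2 with V independent of the argument U of f. *)
Lemma integral_dotp_mehler :
  \int[gauss n]_x ((dotp x x)%:E * \int[gauss n]_y (f (lincomb rho sigma x y))%:E) =
  \int[gauss n]_x ((rho ^+ 2 * dotp x x + sigma ^+ 2 * n%:R) * f x)%:E.
Proof.
pose back (z : n.-tuple R * n.-tuple R) := lincomb rho (- sigma)%R z.1 z.2.
have backE x y : back (lincomb rho sigma x y, lincomb (- sigma)%R rho x y) = x.
  apply: eq_from_tnth => i; rewrite !tnth_mktuple.
  by rewrite -[RHS]mul1r -rs1; ring.
pose F z := (f z.1 * dotp (back z) (back z))%:E.
have mback : measurable_fun [set: n.-tuple R * n.-tuple R] back.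
  exact: measurable_lincomb.
transitivity (\int[gauss n]_x \int[gauss n]_y
    F (lincomb rho sigma x y, lincomb (- sigma)%R rho x y)).
  apply: eq_integral => x _; rewrite -ge0_integralZl//.
  - by apply: eq_integral => y _; rewrite /F backE -EFinM mulrC.
  - apply/measurable_EFinP; apply: measurableT_comp => //.
    exact: measurable_lincomb.
  - by move=> y _; rewrite lee_fin.
  - by rewrite lee_fin dotpxx_ge0.
rewrite (@ge0_integral_gauss_rotation R n _ _ F rs1).
- apply: eq_integral => u _.
  transitivity ((f u)%:E * \int[gauss n]_v
      (dotp (lincomb rho (- sigma) u v) (lincomb rho (- sigma) u v))%:E).
    rewrite -ge0_integralZl//.
    + apply/measurable_EFinP; apply: measurable_dotp; exact: measurable_lincomb.
    + by move=> y _; rewrite lee_fin dotpxx_ge0.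
    + by rewrite lee_fin.
  by rewrite integral_gauss_lincomb_dotp -EFinM sqrrN mulrC.
- apply/measurable_EFinP; apply: measurable_funM; first exact: measurableT_comp.
  exact: measurable_dotp.
- by move=> z; rewrite lee_fin mulr_ge0// dotpxx_ge0.
Qed.

End mehler.

End mehler_formula.

Section ou_facts.
Context {R : realType}.
Local Notation N := (normal_prob (0 : R) 1).
Local Notation gauss := (gauss R).
Variables (n : nat) (t : R).
Hypothesis t0 : 0 < t.
Variable f : n.-tuple R -> R.
Hypothesis mf : measurable_fun [set: n.-tuple R] f.
Hypothesis f01 : forall x, 0 <= f x <= 1.

Let rho := expR (- t).
Let sigma := Num.sqrt (1 - expR (- (2 * t))).

Lemma ou_coef_sqr : rho ^+ 2 + sigma ^+ 2 = 1.
Proof.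
rewrite /rho /sigma sqr_sqrtr.
  by rewrite expRN exprVn -expRM_natl -expRN addrC subrK.
by rewrite subr_ge0 -expR0 ler_expR oppr_le0 mulr_ge0// ltW.
Qed.

Let f_le1 x : `|f x| <= 1.
Proof. by have /andP[? ?] := f01 x; rewrite ger0_norm. Qed.

Let f_ge0 x : 0 <= f x. Proof. by have /andP[] := f01 x. Qed.

Let mfl x : measurable_fun [set: n.-tuple R] (fun y => f (lincomb rho sigma x y)).
Proof. by apply: measurableT_comp => //; exact: measurable_lincomb. Qed.

Lemma EFin_ou x :
  (ou t f x)%:E = (\int[gauss n]_y (f (lincomb rho sigma x y))%:E)%E.
Proof.
rewrite /ou unlock -/rho -/sigma.
by rewrite -(EFin_Rintegral (integrable_bounded (gauss n) (mfl x) (fun y => f_le1 _))).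
Qed.

Lemma measurable_ou : measurable_fun [set: n.-tuple R] (ou t f).
Proof.
apply/measurable_EFinP.
apply: (eq_measurable_fun (fun x => \int[gauss n]_y (f (lincomb rho sigma x y))%:E)%E).
  by move=> x _; rewrite -EFin_ou.
apply: (@measurable_fun_fubini_tonelli_F _ _ _ _ R (gauss n)
  (fun z => (f (lincomb rho sigma z.1 z.2))%:E)).
  apply/measurable_EFinP; apply: measurableT_comp => //.
  exact: measurable_lincomb.
by move=> z; rewrite lee_fin.
Qed.

Lemma ou01 x : 0 <= ou t f x <= 1.
Proof.
rewrite -!lee_fin EFin_ou; apply/andP; split.
  by apply: integral_ge0 => y _; rewrite lee_fin.
apply: (@le_trans _ _ (\int[gauss n]_y (cst 1%E y))%E); last first.
  by rewrite integral_cst//= probability_setT mule1.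
apply: ge0_le_integral => //.
- by move=> y _; rewrite lee_fin.
- exact/measurable_EFinP.
- by move=> y _; rewrite lee_fin; have /andP[] := f01 (lincomb rho sigma x y).
Qed.

Lemma ou_le1 x : `|ou t f x| <= 1.
Proof. by have /andP[? ?] := ou01 x; rewrite ger0_norm. Qed.

Lemma coord_sum_onem_sqrE (x : n.-tuple R) : coord_sum onem_sqr x = n%:R - dotp x x.
Proof. by rewrite /coord_sum /onem_sqr sumrB sumr_const card_ord. Qed.

Lemma coord_sum_onem_sqr_moments : let v := \int[N]_x (onem_sqr x ^+ 2) in
   let w := \int[N]_x (onem_sqr x ^+ 4) in
   [/\ forall k, (k <= 4)%N ->
        (gauss n).-integrable setT (EFin \o (fun x => coord_sum onem_sqr x ^+ k)),
      \int[gauss n]_x coord_sum onem_sqr x = 0,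
      \int[gauss n]_x (coord_sum onem_sqr x ^+ 2) = n%:R * v &
      \int[gauss n]_x (coord_sum onem_sqr x ^+ 4) <= n%:R ^+ 2 * (w + 3 * v ^+ 2) ].
Proof.
apply: coord_sum_moments => //; first exact: measurable_onem_sqr.
  by move=> k; exact: integrable_onem_sqrX.
exact: Rintegral_onem_sqr.
Qed.

Lemma integrable_coord_sum_onem_sqrM (h : n.-tuple R -> R) :
  measurable_fun [set: n.-tuple R] h -> (forall x, `|h x| <= 1) ->
  (gauss n).-integrable setT (EFin \o (fun x => coord_sum onem_sqr x * h x)).
Proof.
move=> mh h1; have [iS _ _ _] := coord_sum_onem_sqr_moments.
apply: (@le_integrable _ _ _ (gauss n) _ measurableT _
    (EFin \o (fun x => coord_sum onem_sqr x ^+ 1))).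
- apply/measurable_EFinP; apply: measurable_funM => //.
  apply: measurable_coord_sum; exact: measurable_onem_sqr.
- by move=> x _; rewrite /= lee_fin normrM expr1 ler_piMr.
- exact: iS.
Qed.

Lemma Rintegral_coord_sum_onem_sqrM (h : n.-tuple R -> R) :
  measurable_fun [set: n.-tuple R] h -> (forall x, `|h x| <= 1) ->
  (gauss n).-integrable setT (EFin \o (fun x => dotp x x * h x)) /\
  \int[gauss n]_x (coord_sum onem_sqr x * h x) =
  n%:R * \int[gauss n]_x h x - \int[gauss n]_x (dotp x x * h x).
Proof.
move=> mh h1.
have ih := integrable_bounded (gauss n) mh h1.
have inh := @integrableZl _ _ _ (gauss n) _ measurableT n%:R _ ih.
have iSh := integrable_coord_sum_onem_sqrM mh h1.
have idh : (gauss n).-integrable setT (EFin \o (fun x => dotp x x * h x)).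
  apply: eq_integrable (@integrableB _ _ _ (gauss n) _ measurableT _ _ inh iSh) => //.
  by move=> x _; rewrite /= -EFinB coord_sum_onem_sqrE; congr EFin; ring.
split => //.
rewrite -(@RintegralZl _ _ _ (gauss n) setT h n%:R measurableT ih).
rewrite -(@RintegralB _ _ _ (gauss n) setT _ _ measurableT inh idh).
by apply: eq_Rintegral => x _; rewrite /= coord_sum_onem_sqrE mulrBl.
Qed.

Lemma Rintegral_ou : \int[gauss n]_x ou t f x = \int[gauss n]_x f x.
Proof.
rewrite /Rintegral; congr fine; rewrite -(integral_mehler ou_coef_sqr mf f_ge0).
by apply: eq_integral => x _; rewrite EFin_ou.
Qed.

(** The semigroup is self-adjoint, and n - |x|^2 belongs to the second chaos,
its eigenspace for the eigenvalue rho^2. *)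
Lemma Rintegral_coord_sum_onem_sqr_ou :
  \int[gauss n]_x (coord_sum onem_sqr x * ou t f x) =
  rho ^+ 2 * \int[gauss n]_x (coord_sum onem_sqr x * f x).
Proof.
have [ig ->] := Rintegral_coord_sum_onem_sqrM measurable_ou ou_le1.
have [idf ->] := Rintegral_coord_sum_onem_sqrM mf f_le1.
have iF := integrable_bounded (gauss n) mf f_le1.
have -> : \int[gauss n]_x (dotp x x * ou t f x) =
    rho ^+ 2 * \int[gauss n]_x (dotp x x * f x) +
    sigma ^+ 2 * n%:R * \int[gauss n]_x f x.
  rewrite -(@RintegralZl _ _ _ (gauss n) setT _ (rho ^+ 2) measurableT idf).
  rewrite -(@RintegralZl _ _ _ (gauss n) setT _ (sigma ^+ 2 * n%:R) measurableT iF).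
  rewrite -(@RintegralD _ _ _ (gauss n) setT _ _ measurableT
    (@integrableZl _ _ _ (gauss n) _ measurableT _ _ idf)
    (@integrableZl _ _ _ (gauss n) _ measurableT _ _ iF)).
  transitivity (\int[gauss n]_x ((rho ^+ 2 * dotp x x + sigma ^+ 2 * n%:R) * f x)).
    rewrite /Rintegral; congr fine.
    rewrite -(integral_dotp_mehler ou_coef_sqr mf f_ge0).
    by apply: eq_integral => x _; rewrite EFinM EFin_ou.
  by apply: eq_Rintegral => x _; rewrite mulrDl mulrA.
rewrite Rintegral_ou; have := ou_coef_sqr.
move: (Rintegral _ _ (fun x => dotp x x * f x)) (Rintegral _ _ f) => a b rs.
have -> : sigma ^+ 2 = 1 - rho ^+ 2 by rewrite -rs; ring.
by ring.
Qed.

End ou_facts.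

(** * Noise stability of the ball *)

Section stability.
Context {R : realType}.
Local Notation N := (normal_prob (0 : R) 1).
Local Notation gauss := (gauss R).

Lemma variance_bounded d (T : measurableType d) (P : probability T R) (f : T -> R) (M : R) :
  measurable_fun [set: T] f -> (forall x, `|f x| <= M) ->
  ('V_P[f] = (\int[P]_x ((f x - \int[P]_y f y) ^+ 2))%:E)%E.
Proof.
move=> mf fM; set m := Rintegral _ _ f.
have iM : P.-integrable setT (EFin \o (fun x => (f x - m) ^+ 2)).
  apply: (@integrable_bounded _ _ _ P _ ((M + `|m|) ^+ 2)).
    by apply: measurable_funX; exact: measurable_funB.
  move=> x; rewrite normrX lerXn2r ?nnegrE//.
    by rewrite addr_ge0// (le_trans _ (fM x)).
  by rewrite (le_trans (ler_normB _ _))// lerD2r.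
transitivity (\int[P]_x ((f x - m) ^+ 2)%:E)%E; last exact/esym/(EFin_Rintegral iM).
by rewrite /variance !unlock.
Qed.

(** For all K > 0, s^2 <= K |s| + s^4 / K^2: compare |s| with K. Integrating
with K^2 = 2 b / a, the quartic term is at most a / 2, so that the first moment
carries at least a / 2. *)
Lemma abs_moment_lower_bound d (T : measurableType d) (P : probability T R)
    (S : T -> R) (a b : R) : 0 < a -> 0 < b ->
  (forall k, (k <= 4)%N -> P.-integrable setT (EFin \o (fun x => S x ^+ k))) ->
  \int[P]_x (S x ^+ 2) = a -> \int[P]_x (S x ^+ 4) <= b ->
  a ^+ 3 <= 8 * b * (\int[P]_x `|S x|) ^+ 2.
Proof.
move=> a0 b0 iS S2 S4; set I := Rintegral _ _ _.
pose K := Num.sqrt (2 * b / a).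
have K2 : K ^+ 2 = 2 * b / a by rewrite sqr_sqrtr// divr_ge0// ltW// mulr_gt0.
have K0 : 0 < K by rewrite sqrtr_gt0 divr_gt0// mulr_gt0.
have iabs : P.-integrable setT (EFin \o (fun x => `|S x|)).
  exact: (@integrable_norm _ _ _ P _ (fun x => S x ^+ 1) (iS 1%N isT)).
have I0 : 0 <= I by apply: Rintegral_ge0.
have key : a <= K * I + (K ^+ 2)^-1 * \int[P]_x (S x ^+ 4).
  have i1 := @integrableZl _ _ _ P _ measurableT K _ iabs.
  have i2 := @integrableZl _ _ _ P _ measurableT (K ^+ 2)^-1 _ (iS 4%N isT).
  rewrite -(@RintegralZl _ _ _ P setT _ K measurableT iabs).
  rewrite -(@RintegralZl _ _ _ P setT _ (K ^+ 2)^-1 measurableT (iS 4%N isT)).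
  rewrite -(@RintegralD _ _ _ P setT _ _ measurableT i1 i2) -S2.
  apply: (@le_Rintegral _ _ _ P setT _ _ measurableT (iS 2%N isT)).
    exact: (@integrableD _ _ _ P _ measurableT _ _ i1 i2).
  move=> x _; rewrite -(real_normK (num_real (S x))).
  have -> : S x ^+ 4 = (`|S x| ^+ 2) ^+ 2 by rewrite real_normK ?num_real// -exprM.
  have s0 := normr_ge0 (S x); move: `|S x| s0 => s s0.
  have [sK|Ks] := leP s K.
    apply: ler_wpDr; first by rewrite mulr_ge0 ?invr_ge0 ?sqr_ge0.
    by rewrite expr2 ler_wpM2r.
  apply: ler_wpDl; first by rewrite mulr_ge0// ltW.
  rewrite mulrC ler_pdivlMr ?exprn_gt0// expr2 ler_wpM2l ?sqr_ge0//.
  by rewrite ler_pXn2r ?nnegrE// ltW.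
have key2 : a / 2 <= K * I.
  have : (K ^+ 2)^-1 * \int[P]_x (S x ^+ 4) <= a / 2.
    have -> : a / 2 = (K ^+ 2)^-1 * b by rewrite K2; field; rewrite !gt_eqF.
    by rewrite ler_wpM2l// invr_ge0 sqr_ge0.
  by move: key; move: (_ * Rintegral _ _ _) => J; lra.
have : (a / 2) ^+ 2 <= (K * I) ^+ 2.
  by rewrite ler_pXn2r ?nnegrE ?mulr_ge0 ?divr_ge0// ltW.
rewrite [leRHS]exprMn K2 => h.
have -> : a ^+ 3 = 4 * a * (a / 2) ^+ 2 by field.
have -> : 8 * b * I ^+ 2 = 4 * a * (2 * b / a * I ^+ 2) by field; rewrite gt_eqF.
by rewrite ler_wpM2l// mulr_ge0// ltW.
Qed.

(** With S the coordinate sum and g = P_t 1_B, Cauchy-Schwarz gives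
E[S (g - E g)]^2 <= n v Var g, where v is the variance of 1 - x_1^2. The
left-hand side is (rho^2 E|S| / 2)^2 and E|S|^2 >= n v^3 / (8 C), so that n
cancels. *)
Lemma variance_ou_sqrt_ball_ge (t : R) : 0 < t ->
  exists2 e : R, 0 < e & forall n, (0 < n)%N ->
    (e%:E <= 'V_(gauss n)[ou t (\1_(sqrt_ball R n))])%E.
Proof.
move=> t0; pose v := \int[N]_x (onem_sqr x ^+ 2); pose w := \int[N]_x (onem_sqr x ^+ 4).
have v0 : 0 < v by exact: Rintegral_onem_sqr2_gt0.
have w0 : 0 <= w by apply: Rintegral_ge0 => x _; rewrite exprn_even_ge0.
pose C := w + 3 * v ^+ 2.
have C0 : 0 < C by rewrite ltr_wpDl// mulr_gt0// exprn_gt0.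
pose rho := expR (- t).
have r0 : 0 < rho by exact: expR_gt0.
exists (rho ^+ 4 * v ^+ 2 / (32 * C)).
  by rewrite divr_gt0// mulr_gt0// exprn_gt0.
move=> n n0; have npos : 0 < n%:R :> R by rewrite ltr0n.
pose f x : R := \1_(sqrt_ball R n) x.
have fE x : f x = (dotp x x <= n%:R)%R%:R by exact: sqrt_ball_indicE.
have mf : measurable_fun [set: n.-tuple R] f by exact: measurable_sqrt_ball_indic.
have f01 x : 0 <= f x <= 1 by rewrite fE; case: (dotp x x <= n%:R); rewrite /= lexx ler01.
pose g := ou t f.
have mg : measurable_fun [set: n.-tuple R] g by exact: measurable_ou.
have g1 x : `|g x| <= 1 by exact: ou_le1.
rewrite -[\1__]/f -/g (variance_bounded (gauss n) mg g1) lee_fin.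
set m := Rintegral _ _ g; set V := Rintegral _ _ _.
have [iS S1 S2 S4] := coord_sum_onem_sqr_moments (R := R) n.
pose S (x : n.-tuple R) := coord_sum onem_sqr x.
pose I := \int[gauss n]_x `|S x|.
(* E S = 0, and S 1_B is the positive part of S *)
have ISf : \int[gauss n]_x (S x * f x) = I / 2.
  have iabs : (gauss n).-integrable setT (EFin \o (fun x => `|S x|)).
    exact: (@integrable_norm _ _ _ (gauss n) _ (fun x => S x ^+ 1) (iS 1%N isT)).
  have iSS := @integrableD _ _ _ (gauss n) _ measurableT _ _ iabs (iS 1%N isT).
  transitivity (\int[gauss n]_x (2^-1 * (`|S x| + S x ^+ 1))).
    apply: eq_Rintegral => x _; rewrite fE expr1.
    have -> : (dotp x x <= n%:R) = (0 <= S x) by rewrite /S coord_sum_onem_sqrE subr_ge0.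
    have [s0|s0] := leP 0 (S x); first by rewrite ger0_norm//=; field.
    by rewrite ltr0_norm//= mulr0 addNr mulr0.
  rewrite (@RintegralZl _ _ _ (gauss n) setT _ 2^-1 measurableT iSS).
  rewrite (@RintegralD _ _ _ (gauss n) setT _ _ measurableT iabs (iS 1%N isT)).
  have -> : \int[gauss n]_x (S x ^+ 1) = 0 by exact: S1.
  by rewrite addr0 mulrC.
have iSg := integrable_coord_sum_onem_sqrM mg g1.
have iSgm : (gauss n).-integrable setT (EFin \o (fun x => S x * (g x - m))).
  have := @integrableB _ _ _ (gauss n) _ measurableT _ _ iSg
    (@integrableZl _ _ _ (gauss n) _ measurableT m _ (iS 1%N isT)).
  apply: eq_integrable => // x _; rewrite /= expr1 -EFinB; congr EFin.
  by rewrite /S; ring.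
have Sg : \int[gauss n]_x (S x * (g x - m)) = rho ^+ 2 * (I / 2).
  rewrite -ISf -(Rintegral_coord_sum_onem_sqr_ou t0 mf f01).
  transitivity (\int[gauss n]_x (S x * g x - m * S x ^+ 1)).
    by apply: eq_Rintegral => x _; rewrite expr1; ring.
  rewrite (@RintegralB _ _ _ (gauss n) setT _ _ measurableT iSg
    (@integrableZl _ _ _ (gauss n) _ measurableT m _ (iS 1%N isT))).
  rewrite (@RintegralZl _ _ _ (gauss n) setT _ m measurableT (iS 1%N isT)).
  have -> : \int[gauss n]_x (coord_sum onem_sqr x ^+ 1) = 0 by exact: S1.
  by rewrite mulr0 subr0.
have CS : (rho ^+ 2 * (I / 2)) ^+ 2 <= n%:R * v * V.
  rewrite -Sg -S2; apply: Rintegral_Cauchy_Schwarz.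
  - exact: iS.
  - apply: (@integrable_bounded _ _ _ (gauss n) _ ((1 + `|m|) ^+ 2)).
      by apply: measurable_funX; exact: measurable_funB.
    move=> x; rewrite normrX lerXn2r ?nnegrE//.
    by rewrite (le_trans (ler_normB _ _))// lerD2r.
  - exact: iSgm.
have low : (n%:R * v) ^+ 3 <= 8 * (n%:R ^+ 2 * C) * I ^+ 2.
  by apply: abs_moment_lower_bound => //; rewrite ?mulr_gt0// exprn_gt0.
rewrite ler_pdivrMr ?mulr_gt0//.
rewrite -(ler_pM2l (_ : 0 < n%:R ^+ 3 * v)); last by rewrite mulr_gt0// exprn_gt0.
apply: (@le_trans _ _ (rho ^+ 4 * (8 * (n%:R ^+ 2 * C) * I ^+ 2))).
  rewrite [leLHS](_ : _ = rho ^+ 4 * (n%:R * v) ^+ 3); last by ring.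
  by rewrite ler_wpM2l// ltW// exprn_gt0.
rewrite [leLHS](_ : _ = 32 * C * n%:R ^+ 2 * (rho ^+ 2 * (I / 2)) ^+ 2); last by field.
rewrite [leRHS](_ : _ = 32 * C * n%:R ^+ 2 * (n%:R * v * V)); last by ring.
by rewrite ler_wpM2l// ltW// !mulr_gt0// exprn_gt0.
Qed.

Lemma noise_stable_sqrt_ball : noise_stable (fun i : nat => sqrt_ball R i.+1).
Proof.
move=> /(_ 1 ltr01) cv.
have [e e0 Ve] := variance_ou_sqrt_ball_ge (ltr01 : 0 < 1 :> R).
suff : (e%:E <= 0)%E by rewrite lee_fin leNgt e0.
apply: (cvge_ge _ cv); apply: nearW => i; exact: Ve.
Qed.

End stability.

Theorem proposition1p4 (R : realType) :
  noise_stable (fun i : nat => sqrt_ball R i.+1) /\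
  (forall n : nat, (1 <= n)%N ->
     (maxcov (sqrt_ball R n) <= (n%:R `^ (- 2^-1))%:E)%E).
Proof.
split; first exact: noise_stable_sqrt_ball.
by move=> n n0; exact: maxcov_sqrt_ball_le.
Qed.
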